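(* Suppose that $b$ and $\sigma$ satisfy the following conditions. (i) There exist constants $K_1,K_2>0$ such that for all $x,y\in\mathbb{R}^d$ and $\mu,\nu\in\mathcal{P}_2(\mathbb{R}^d)$, $$2\langle x-y,b(x,\mu)-b(y,\nu)\rangle+\|\sigma(x,\mu)-\sigma(y,\nu)\|^2\leq -K_1|x-y|^2+K_2\mathbb{W}_2(\mu,\nu)^2.$$ (ii) There exist constants $b_1,b_2>0$ such that for all $x\in\mathbb{R}^d$ and $\mu\in\mathcal{P}_2(\mathbb{R}^d)$, $$|b(x,\mu)|^2\leq b_1|x|^2+b_2\mathcal{W}_2(\mu)^2.$$ (iii) There exist constants $c_1,c_2>0$ such that for all $x\in\mathbb{R}^d$ and $\mu\in\mathcal{P}_2(\mathbb{R}^d)$, $$2\langle x,b(x,\mu)\rangle+m\|\sigma(x,\mu)\|^2\leq-c_1|x|^2+c_2\mathcal{W}_2(\mu)^2,$$ where $m$ is the dimension of the Brownian motion. Assume $0<c_2<c_1$. Then there exists a stepsize $\bar\Delta_0\in(0,1)$ such that for any $\Delta\in(0,\bar\Delta_0)$ the Euler-Maruyama numerical solution $Y^{j,N}_{t_k}$ is almost surely exponentially stable, i.e., almost surely $$\limsup_{k\to\infty}\frac{1}{k\Delta}\log\Big(\frac1N\sum_{i=1}^N|Y^{i,N}_{t_k}|^2\Big)\leq-\xi^*_\Delta,$$ where $\xi^*_\Delta$ is a positive constant (depending on $\Delta$) satisfying $\lim_{\Delta\to0}\xi^*_\Delta=c_1-c_2$.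
   Context: $(\Omega,\mathcal{F},(\mathcal{F}_t)_{t\ge0},\mathbb{P})$ is a complete filtered probability space satisfying the usual conditions. $|\cdot|$ is the Euclidean norm on $\mathbb{R}^d$ and $\|\cdot\|$ is the Frobenius norm on $\mathbb{R}^{d\times m}$. $\mathcal{P}_2(\mathbb{R}^d)$ is the set of probability measures on $\mathbb{R}^d$ with finite second moment, $\mathbb{W}_2$ is the 2-Wasserstein distance on it, and $\mathcal{W}_2(\mu)=\left(\int_{\mathbb{R}^d}|x|^2\mu(dx)\right)^{1/2}$. The coefficients $b:\mathbb{R}^d\times\mathcal{P}_2(\mathbb{R}^d)\to\mathbb{R}^d$ and $\sigma:\mathbb{R}^d\times\mathcal{P}_2(\mathbb{R}^d)\to\mathbb{R}^{d\times m}$ are Borel measurable and locally Lipschitz with respect to $x$. $X_0$ is a non-zero $\mathcal{F}_0$-measurable $\mathbb{R}^d$-valued random variable with $\mathbb{E}|X_0|^{p}<\infty$ for all $p\ge2$, and $W$ is an $m$-dimensional $(\mathcal{F}_t)$-Brownian motion. Let $N\geq 1$ be an integer, $\mathbb{S}_N=\{1,\dots,N\}$, and for $j\in\mathbb{S}_N$ let $(W^j,X_0^j)$ be independent copies of $(W,X_0)$. Stepsizes are of the form $\Delta=1/M$ with $M$ a positive integer, and $t_k=k\Delta$, $k=0,1,2,\dots$. The Euler-Maruyama scheme for the interacting particle system is $$Y^{j,N}_{t_{k+1}}=Y^{j,N}_{t_k}+b(Y^{j,N}_{t_k},\mu^{Y,N}_{t_k})\Delta+\sigma(Y^{j,N}_{t_k},\mu^{Y,N}_{t_k})\Delta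 W^j_{t_k},\qquad Y^{j,N}_0=X^j_0,\quad j\in\mathbb{S}_N,$$ where $\Delta W^j_{t_k}=W^j_{t_{k+1}}-W^j_{t_k}$ and $\mu^{Y,N}_{t_k}=\frac1N\sum_{i=1}^N\delta_{Y^{i,N}_{t_k}}$. Convention: $\log 0=-\infty$. *)

(* Defs.v *)
From HB Require Import structures.
From mathcomp Require Import all_boot all_order all_algebra.
From mathcomp Require Import all_classical all_reals all_analysis.
From mathcomp Require Import measurable_realfun.

Set Implicit Arguments.
Unset Strict Implicit.
Unset Printing Implicit Defensive.
Import Order.TTheory GRing.Theory Num.Theory.
Import numFieldNormedType.Exports.

Local Open Scope classical_set_scope.
Local Open Scope ring_scope.

(* Vectors of R^d are columns 'cV[R]_d, so that a diffusion matrix acts on a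
   Brownian increment by *m.  The library norm of a matrix is the sup norm,
   hence the two norms below. *)

Definition dotv (R : realType) (d : nat) (x y : 'cV[R]_d) : R :=
  \sum_(i < d) x i 0 * y i 0.

Definition enorm (R : realType) (d : nat) (x : 'cV[R]_d) : R :=
  Num.sqrt (\sum_(i < d) x i 0 ^+ 2).

Definition fnorm (R : realType) (p q : nat) (A : 'M[R]_(p, q)) : R :=
  Num.sqrt (\sum_(i < p) \sum_(j < q) A i j ^+ 2).

(* R^(p x q) with its Borel sigma-algebra; convertible to 'M[R]_(p, q). *)
Definition bmx (R : realType) (p q : nat) :=
  g_sigma_algebraType (@open 'M[R]_(p, q)).

Definition bvec (R : realType) (d : nat) := bmx R d 1.

Definition borel_mx (R : realType) (p q : nat) : set (set 'M[R]_(p, q)) :=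
  @measurable _ (bmx R p q).

Lemma measurable_coord (R : realType) (p q : nat) (i : 'I_p) (j : 'I_q) :
  measurable_fun setT (fun A : bmx R p q => (A : 'M[R]_(p, q)) i j).
Proof.
apply: (measurability _ (RGenOpens.measurableE R)).
move=> _ [_ [a [b ->] <-]]; rewrite setTI; apply: sub_sigma_algebra.
apply: open_comp; last exact: interval_open.
by move=> A _; exact: coord_continuous.
Qed.

Lemma enorm_sq (R : realType) (d : nat) (x : 'cV[R]_d) :
  enorm x ^+ 2 = \sum_(i < d) x i 0 ^+ 2.
Proof. by rewrite sqr_sqrtr// sumr_ge0// => i _; exact: sqr_ge0. Qed.

Lemma measurable_enorm_sq (R : realType) (d : nat) :
  measurable_fun setT (fun x : bvec R d => enorm (x : 'cV[R]_d) ^+ 2).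
Proof.
under eq_fun do rewrite enorm_sq.
apply: (@measurable_sum _ (bvec R d)) => i.
by apply: measurable_funX; exact: (@measurable_coord R d 1 i 0).
Qed.

Record P2 (R : realType) (d : nat) := MkP2 {
  p2_prob :> probability (bvec R d) R ;
  p2_moment :
    (\int[p2_prob]_x (enorm (x : 'cV[R]_d) ^+ 2)%:E < +oo)%E }.

(* The calligraphic W_2(mu): the distance from mu to the Dirac mass at 0. *)
Definition moment2 (R : realType) (d : nat) (mu : P2 R d) : R :=
  Num.sqrt (fine (\int[mu]_x (enorm (x : 'cV[R]_d) ^+ 2)%:E)%E).

Definition coupling (R : realType) (d : nat) (mu nu : P2 R d) :
    set (probability (bvec R d * bvec R d)%type R) :=
  [set pi | forall A : set (bvec R d), measurable A ->
     pi (A `*` setT) = mu A /\ pi (setT `*` A) = nu A].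

(* The infimum is finite on P2 (take the product coupling), so that fine
   loses nothing. *)
Definition W2 (R : realType) (d : nat) (mu nu : P2 R d) : R :=
  Num.sqrt (fine (ereal_inf
    [set (\int[pi]_z (enorm ((z.1 : 'cV[R]_d) - (z.2 : 'cV[R]_d)) ^+ 2)%:E)%E
     | pi in coupling mu nu])).

(* Open sets of R^d x P2(R^d), where P2(R^d) has the topology of W2. *)
Definition open_xmu (R : realType) (d : nat) : set (set ('cV[R]_d * P2 R d)) :=
  [set U | forall x mu, U (x, mu) -> exists2 e : R, 0 < e &
     forall y nu, enorm (y - x) < e -> W2 mu nu < e -> U (y, nu)].

Definition borel_measurable_xmu (R : realType) (d p q : nat)
    (f : 'cV[R]_d -> P2 R d -> 'M[R]_(p, q)) : Prop :=
  forall B, @borel_mx R p q B ->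
    <<s @open_xmu R d >> [set z | B (f z.1 z.2)].

(* The Lipschitz constant on a ball may depend on mu. *)
Definition locally_lipschitz_x (R : realType) (d p q : nat)
    (f : 'cV[R]_d -> P2 R d -> 'M[R]_(p, q)) : Prop :=
  forall (mu : P2 R d) (r : R), exists L : R, forall x y : 'cV[R]_d,
    enorm x <= r -> enorm y <= r ->
    fnorm (f x mu - f y mu) <= L * enorm (x - y).

Section empirical_measure.
Context (R : realType) (d N : nat) (hN : (0 < N)%N) (y : 'I_N -> 'cV[R]_d).
Local Open Scope ereal_scope.

Definition emp (A : set (bvec R d)) : \bar R :=
  (N%:R^-1)%:E * \sum_(i < N) \d_(y i : bvec R d) A.

Let ext (n : nat) : bvec R d := y (insubd (Ordinal hN) n).

Let extE (i : 'I_N) : ext i = y i.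
Proof.
by rewrite /ext; congr y; apply: val_inj; rewrite val_insubd ltn_ord.
Qed.

Let invN_ge0 : (0 <= N%:R^-1 :> R)%R.
Proof. by rewrite invr_ge0. Qed.

Let invN : {nonneg R} := NngNum invN_ge0.

Let emp_mscale :
  emp = mscale invN (msum (fun n => \d_(ext n) : {measure set _ -> \bar R}) N).
Proof.
apply/funext => A; rewrite /emp /mscale /msum /=; congr (_ * _).
by apply: eq_bigr => i _; rewrite extE.
Qed.

Let emp0 : emp set0 = 0.
Proof. by rewrite emp_mscale measure0. Qed.

Let emp_ge0 A : 0 <= emp A.
Proof. by rewrite emp_mscale measure_ge0. Qed.

Let emp_sigma_additive : semi_sigma_additive emp.
Proof. by rewrite emp_mscale; exact: measure_semi_sigma_additive. Qed.

HB.instance Definition _ := isMeasure.Build _ (bvec R d) R emp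
  emp0 emp_ge0 emp_sigma_additive.

Let emp_setT : emp setT = 1.
Proof.
rewrite /emp (eq_bigr (fun=> (1%R)%:E)) => [|i _]; last by rewrite diracT.
by rewrite sumEFin sumr_const card_ord -EFinM mulVf// pnatr_eq0 -lt0n.
Qed.

HB.instance Definition _ := Measure_isProbability.Build _ (bvec R d) R emp
  emp_setT.

Lemma ge0_integral_emp (f : bvec R d -> \bar R) :
  measurable_fun setT f -> (forall x, 0 <= f x) ->
  \int[emp]_x f x = (N%:R^-1)%:E * \sum_(i < N) f (y i).
Proof.
move=> mf f0.
transitivity (\int[mscale invN
    (msum (fun n => \d_(ext n) : {measure set _ -> \bar R}) N)]_x f x).
  by apply: eq_measure_integral => A _ _; rewrite [LHS]/= emp_mscale.
rewrite ge0_integral_mscale//; congr (_ * _).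
rewrite ge0_integral_measure_sum//; apply: eq_bigr => i _.
by rewrite integral_dirac// diracT mul1e extE.
Qed.

Let emp_moment : \int[emp]_x (enorm (x : 'cV[R]_d) ^+ 2)%:E < +oo.
Proof.
rewrite ge0_integral_emp.
- by rewrite sumEFin -EFinM ltry.
- by apply/measurable_EFinP; exact: measurable_enorm_sq.
- by move=> x; rewrite lee_fin sqr_ge0.
Qed.

Definition empirical : P2 R d := MkP2 emp_moment.

End empirical_measure.

Section stochastic_basis.
Context (R : realType) (disp : measure_display) (T : measurableType disp)
        (P : probability T R).

(* A filtration is given by F t for 0 <= t; the values at t < 0 are unused,
   here and for the processes below. *)
Record usual_filtration (F : R -> set (set T)) : Prop := UsualFiltration {
  uf_complete : measure_is_complete P ;
  uf_sigma : forall t : R, 0 <= t -> sigma_algebra setT (F t) ;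
  uf_sub : forall t : R, 0 <= t -> F t `<=` measurable ;
  uf_mono : forall s t : R, 0 <= s -> s <= t -> F s `<=` F t ;
  uf_null : forall A, P.-negligible A -> F 0 A ;
  uf_right : forall t : R, 0 <= t -> \bigcap_(s in [set s | t < s]) F s `<=` F t }.

Definition measurable_wrt (G : set (set T)) (p q : nat)
    (X : T -> 'M[R]_(p, q)) : Prop :=
  forall B, @borel_mx R p q B -> G (X @^-1` B).

Definition continuous_paths (m : nat) (W : R -> T -> 'cV[R]_m) : Prop :=
  {ae P, forall w, {within [set t : R | 0 <= t], continuous (fun t => W t w)}}.

Record brownian_motion (F : R -> set (set T)) (m : nat)
    (W : R -> T -> 'cV[R]_m) : Prop := BrownianMotion {
  bm_adapted : forall t : R, 0 <= t -> measurable_wrt (F t) (W t) ;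
  bm_start : {ae P, forall w, W 0 w = 0} ;
  bm_continuous : continuous_paths W ;
  bm_indep : forall s t : R, 0 <= s -> s < t ->
    forall (A : set T) (B : set 'cV[R]_m), F s A -> @borel_mx R m 1 B ->
    P (A `&` [set w | B (W t w - W s w)]) =
    (P A * P [set w | B (W t w - W s w)%R])%E ;
  (* the law of W t - W s is N(0, (t - s) I_m); normal_prob takes the standard
     deviation *)
  bm_gauss : forall s t : R, 0 <= s -> s < t ->
    forall A : 'I_m -> set R, (forall i, measurable (A i)) ->
    P [set w | forall i, A i ((W t w - W s w) i 0)] =
    (\prod_(i < m) normal_prob 0 (Num.sqrt (t - s)) (A i))%E }.

Definition path_space (d m : nat) : Type := ('cV[R]_d * (R -> 'cV[R]_m))%type.

(* The product sigma-algebra on R^d x (R^m)^[0, +oo[. *)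
Definition path_sigma (d m : nat) : set (set (path_space d m)) :=
  <<s [set C | (exists2 A : set 'cV[R]_d, @borel_mx R d 1 A &
                  C = [set z | A z.1])
             \/ (exists t : R, 0 <= t /\
                  exists2 A : set 'cV[R]_m, @borel_mx R m 1 A &
                  C = [set z | A (z.2 t)])] >>.

Definition path_elt (d m : nat) (W : R -> T -> 'cV[R]_m) (X0 : T -> 'cV[R]_d) :
  T -> path_space d m := fun w => (X0 w, fun t => W t w).

(* (Wc j, X0c j), j < N, are independent random elements of
   R^d x C([0, +oo[, R^m), each with the law of (W, X0).  They need not be
   adapted to the filtration that carries (W, X0). *)
Record independent_copies (d m N : nat)
    (W : R -> T -> 'cV[R]_m) (X0 : T -> 'cV[R]_d)
    (Wc : 'I_N -> R -> T -> 'cV[R]_m) (X0c : 'I_N -> T -> 'cV[R]_d) : Prop :=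
  IndependentCopies {
  ic_measurable : forall (j : 'I_N) C, path_sigma C ->
    measurable (path_elt (Wc j) (X0c j) @^-1` C) ;
  ic_continuous : forall j : 'I_N, continuous_paths (Wc j) ;
  ic_law : forall (j : 'I_N) C, path_sigma C ->
    P (path_elt (Wc j) (X0c j) @^-1` C) = P (path_elt W X0 @^-1` C) ;
  ic_indep : forall C : 'I_N -> set (path_space d m),
    (forall j, path_sigma (C j)) ->
    P [set w | forall j, C j (path_elt (Wc j) (X0c j) w)] =
    (\prod_(j < N) P (path_elt (Wc j) (X0c j) @^-1` C j))%E }.

End stochastic_basis.

(* euler b sigma hN D W X0 k j w is Y^{j,N}_{t_k}(w) for the stepsize D. *)
Fixpoint euler (R : realType) (T : Type) (d m N : nat)
    (b : 'cV[R]_d -> P2 R d -> 'cV[R]_d)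
    (sigma : 'cV[R]_d -> P2 R d -> 'M[R]_(d, m)) (hN : (0 < N)%N) (D : R)
    (W : 'I_N -> R -> T -> 'cV[R]_m) (X0 : 'I_N -> T -> 'cV[R]_d)
    (k : nat) (j : 'I_N) (w : T) : 'cV[R]_d :=
  match k with
  | 0 => X0 j w
  | k'.+1 =>
    let y i := euler b sigma hN D W X0 k' i w in
    let mu := empirical hN y in
    y j + D *: b (y j) mu
        + sigma (y j) mu *m (W j (k'.+1%:R * D) w - W j (k'%:R * D) w)
  end.

Definition stepsize (R : realType) (D : R) : Prop :=
  exists2 M : nat, (0 < M)%N & D = M%:R^-1.

(* Main.v *)
(* Let [S_k] be the empirical second moment of the particles at time [k D].
   Expanding the square in the scheme, the increment of the noise over a step is
   centered and independent of the past, so the cross term has expectation zero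
   and [E S_(k+1)] is at most the expectation of the average over the particles
   of [|Y + D b|^2 + m D |sigma|^2].  By (ii) and (iii) this average is at most
   [(1 - D xi) S_k] with [xi = c1 - c2 - D (b1 + b2)], hence
   [E S_k <= exp (- k D xi) E S_0].  For every [e > 0] the series with terms
   [exp (k D (xi - e)) S_k] then has a finite expectation, so it converges
   almost surely, which bounds the exponential rate by [- xi + e]. *)

Require Import Defs.
From HB Require Import structures.
From mathcomp Require Import all_boot all_order all_algebra.
From mathcomp Require Import all_classical all_reals all_analysis.
From mathcomp Require Import measurable_realfun ring lra.

Set Implicit Arguments.
Unset Strict Implicit.
Unset Printing Implicit Defensive.
Import Order.TTheory GRing.Theory Num.Theory.
Import numFieldNormedType.Exports.
Import HBNNSimple.

Local Open Scope classical_set_scope.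
Local Open Scope ring_scope.

(** * Normal moments and products of independent variables *)

(** The factor [m] in (iii) pays for the bound [|sigma xi|^2 <= |sigma|^2 |xi|^2], since each of the
    [m] coordinates of an increment [xi] contributes at most [D] to [E |xi|^2]. With this bound only
    one-coordinate marginals of the noise enter, and an upper bound on the normal second moment
    suffices. The main obstacle is that the copies are given by joint independence and by the law of
    [(W, X0)], without a filtration of their own. Independence of an increment from the past of all
    the particles is therefore a statement about path events: on a rectangle, the factor of the
    moving particle is carried back to [(W, X0)] and its filtration, and a Dynkin argument reaches
    the generated sigma-algebra. A second obstacle is that the coefficients are Borel for the [W2]
    topology, so the measurability of the scheme rests on the continuity of the map from particle
    positions to their empirical measure. *)

(** On indicators this is the hypothesis on [nu]; linearity gives simple functions, and monotone
    convergence along [nnsfun_approx] gives [f]. *)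
Lemma ge0_integral_density {d} {T : measurableType d} {R : realType}
    (mu nu : {measure set T -> \bar R}) (p : T -> R) (f : T -> \bar R) :
  measurable_fun setT p -> (forall x, 0 <= p x) ->
  (forall A, measurable A -> nu A = \int[mu]_(x in A) (p x)%:E)%E ->
  measurable_fun setT f -> (forall x, 0 <= f x)%E ->
  (\int[nu]_x f x = \int[mu]_x (f x * (p x)%:E))%E.
Proof.
move=> mp p0 nuE mf f0.
pose f_ := nnsfun_approx measurableT mf.
have fcvg x : (f_ n x)%:E @[n --> \oo] --> f x.
  by apply: cvg_nnsfun_approx => // *; exact: f0.
transitivity (limn (fun n => \int[nu]_x (f_ n x)%:E)%E).
  rewrite -monotone_convergence//.
  - by apply: eq_integral => x _; apply/esym/cvg_lim.
  - by move=> n; exact/measurable_EFinP.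
  - by move=> n x _; rewrite lee_fin.
  - by move=> x _ a b ab; rewrite lee_fin; exact/lefP/nd_nnsfun_approx.
transitivity (limn (fun n => \int[mu]_x ((f_ n x)%:E * (p x)%:E))%E); last first.
  rewrite -monotone_convergence//.
  - apply: eq_integral => x _; apply/cvg_lim => //.
    by apply: cvgeZr => //; exact: fcvg.
  - move=> n; rewrite -/(measurable_fun _ _).
    under eq_fun do rewrite -EFinM.
    by apply/measurable_EFinP; exact: measurable_funM.
  - by move=> n x _; rewrite -EFinM lee_fin mulr_ge0.
  - move=> x _ a b ab; rewrite -!EFinM lee_fin ler_wpM2r//.
    exact/lefP/nd_nnsfun_approx.
congr (limn _); apply/funext => n.
have mE (r : R) : measurable (f_ n @^-1` [set r]) by [].
transitivity (\sum_(k \in range (f_ n))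
   \int[nu]_x (k * \1_(f_ n @^-1` [set k]) x)%:E)%E.
  under eq_integral do rewrite fimfunE -fsumEFin//.
  rewrite ge0_integral_fsum//.
  - by move=> y; exact/measurable_EFinP/measurable_funM.
  - by move=> y x _; rewrite nnfun_muleindic_ge0.
transitivity (\sum_(k \in range (f_ n))
   \int[mu]_x ((k * \1_(f_ n @^-1` [set k]) x)%:E * (p x)%:E))%E; last first.
  rewrite -ge0_integral_fsum//.
  - apply: eq_integral => x _; rewrite [in RHS]fimfunE -fsumEFin//.
    rewrite ge0_mule_fsuml//.
    by move=> r; rewrite EFinM; exact: nnfun_muleindic_ge0.
  - move=> y; under eq_fun do rewrite -EFinM.
    by apply/measurable_EFinP; do 2 apply: measurable_funM => //.
  - by move=> y x _; apply: mule_ge0;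
    [rewrite EFinM nnfun_muleindic_ge0|rewrite lee_fin].
apply: eq_fsbigr => r /[!inE] -[t _ <-].
under [RHS]eq_integral do rewrite EFinM -muleA.
rewrite integralZl_indic_nnsfun// integral_indic// setIT ge0_integralZl//.
- rewrite nuE// integral_mkcond; congr (_ * _)%E.
  by apply: eq_integral => x _; rewrite epatch_indic muleC.
- under eq_fun do rewrite -EFinM.
  by apply/measurable_EFinP; apply: measurable_funM.
- by move=> x _; rewrite mule_ge0// lee_fin.
- by rewrite lee_fin.
Qed.

Section centered_normal_moments.
Context {R : realType}.
Local Notation mu := (@lebesgue_measure R).

Lemma ge0_integral_normal_prob (m s : R) (f : R -> \bar R) :
  measurable_fun setT f -> (forall x, 0 <= f x)%E ->
  (\int[normal_prob m s]_x f x = \int[mu]_x (f x * (normal_pdf m s x)%:E))%E.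
Proof.
move=> mf f0; apply: (@ge0_integral_density _ _ _ mu (normal_prob m s)) => //.
- exact: measurable_normal_pdf.
- exact: normal_pdf_ge0.
Qed.

Let measurable_EFin_pdf (s : R) :
  measurable_fun [set: measurableTypeR R] (fun x => (normal_pdf 0 s x)%:E).
Proof. by apply/measurable_EFinP; exact: measurable_normal_pdf. Qed.

(* [1 + a x^2 <= exp (a x^2)], and for a = (1 - (1 + h)^-2) / (2 s^2) the
   weight [exp (a x^2)] turns the density of standard deviation s into (1 + h)
   times that of standard deviation (1 + h) s. *)
Let tilted_pdf (s h x : R) : 0 < s -> 0 < h ->
  (1 + (1 - (1 + h) ^- 2) / (2 * s ^+ 2) * x ^+ 2) * normal_pdf 0 s x
  <= (1 + h) * normal_pdf 0 (s * (1 + h)) x.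
Proof.
move=> s0 h0; have h1 : 0 < 1 + h by lra.
rewrite !normal_pdfE ?gt_eqF ?mulr_gt0//.
set a := (X in 1 + X * _).
have -> : normal_peak s = (1 + h) * normal_peak (s * (1 + h)).
  rewrite /normal_peak.
  have -> : (s * (1 + h)) ^+ 2 * pi *+ 2 = (1 + h) ^+ 2 * (s ^+ 2 * pi *+ 2).
    by move: pi => p; ring.
  rewrite sqrtrM ?sqr_ge0//.
  by rewrite sqrtr_sqr ger0_norm ?(ltW h1)// invfM mulVKf// gt_eqF.
rewrite [leLHS]mulrC -!mulrA ler_pM2l// ler_wpM2l ?normal_peak_ge0//.
have -> : normal_fun 0 (s * (1 + h)) x = normal_fun 0 s x * expR (a * x ^+ 2).
  rewrite /normal_fun -expRD; congr expR; rewrite /a !subr0.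
  by field; rewrite !gt_eqF.
rewrite ler_wpM2l ?expR_ge0//. rewrite [X in 1 + X]mulrA.
exact: expR_ge1Dx.
Qed.

(** Both densities in [tilted_pdf] have mass one, so integrating it gives [a * v + 1 <= 1 + h].
    Hence [v <= h / a = s^2 (1 + h)^2 / (1 + h / 2)], and [h] tends to 0. *)
Lemma normal_prob_moment2_le (s : R) : 0 < s ->
  (\int[normal_prob 0 s]_x (x ^+ 2)%:E <= (s ^+ 2)%:E)%E.
Proof.
move=> s0; set v := (\int[_]_x _)%E.
have v0 : (0 <= v)%E by apply: integral_ge0 => x _; rewrite lee_fin sqr_ge0.
have key h : 0 < h ->
    ((((1 - (1 + h) ^- 2) / (2 * s ^+ 2))%:E * v + 1 <= (1 + h)%:E)%E).
  move=> h0; have h1 : 0 < 1 + h by lra.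
  set a := (_ / _).
  have a0 : 0 <= a.
    apply: divr_ge0; last by rewrite mulr_ge0 ?sqr_ge0.
    by rewrite subr_ge0 invf_le1 ?exprn_gt0// exprn_ege1//; lra.
  rewrite /v ge0_integral_normal_prob//; last 2 first.
  - exact/measurable_EFinP.
  - by move=> x; rewrite lee_fin sqr_ge0.
  have mf : measurable_fun [set: R] (fun x => (x ^+ 2)%:E * (normal_pdf 0 s x)%:E)%E.
    under eq_fun do rewrite -EFinM.
    apply/measurable_EFinP; apply: measurable_funM => //.
    exact: measurable_normal_pdf.
  have f0 x : (0 <= (x ^+ 2)%:E * (normal_pdf 0 s x)%:E)%E.
    by rewrite -EFinM lee_fin mulr_ge0 ?sqr_ge0 ?normal_pdf_ge0.
  rewrite -(integral_normal_pdf 0 s) -ge0_integralZl//.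
  rewrite -ge0_integralD//; last 3 first.
  - by move=> x _; rewrite mule_ge0.
  - exact: emeasurable_funM.
  - by move=> x _; rewrite lee_fin normal_pdf_ge0.
  rewrite -[leRHS]mule1 -(integral_normal_pdf 0 (s * (1 + h))).
  rewrite -ge0_integralZl//; last 2 first.
  - by move=> x _; rewrite lee_fin normal_pdf_ge0.
  - by rewrite lee_fin ltW.
  apply: ge0_le_integral => //.
  - move=> x _; apply: adde_ge0; first exact: mule_ge0.
    by rewrite lee_fin normal_pdf_ge0.
  - by apply: emeasurable_funD => //; exact: emeasurable_funM.
  - exact: emeasurable_funM.
  - move=> x _; rewrite -!EFinM -EFinD lee_fin.
    apply: le_trans (tilted_pdf x s0 h0); rewrite le_eqVlt -/a.
    by apply/orP; left; apply/eqP; ring.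
have bound h : 0 < h -> (v <= (s ^+ 2 * (1 + h) ^+ 2)%:E)%E.
  move=> h0; have h1 : 0 < 1 + h by lra.
  have a0 : 0 < (1 - (1 + h) ^- 2) / (2 * s ^+ 2).
    apply: divr_gt0; last by rewrite mulr_gt0 ?exprn_gt0.
    by rewrite subr_gt0 invf_lt1 ?exprn_gt0// exprn_egt1//; lra.
  move: (key h h0) v0; case: (v) => [r| |]//; last first.
    by rewrite gt0_muley ?lte_fin// addye.
  rewrite -EFinM -EFinD !lee_fin => H r0.
  have {}H : (1 - (1 + h) ^- 2) / (2 * s ^+ 2) * r <= h by lra.
  rewrite -(ler_pM2l a0); apply: (le_trans H).
  have -> : (1 - (1 + h) ^- 2) / (2 * s ^+ 2) * (s ^+ 2 * (1 + h) ^+ 2)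
      = h + h ^+ 2 / 2.
    by field; rewrite !gt_eqF.
  by rewrite lerDl divr_ge0 ?sqr_ge0.
apply/lee_addgt0Pr => e e0.
have s20 : 0 < s ^+ 2 by rewrite exprn_gt0.
(* For [h <= 1] one has [(1 + h)^2 <= 1 + 3 h], so the excess over [s^2] is at most
   [3 s^2 h <= e]. *)
pose h := Num.min 1 (e / (3 * s ^+ 2)).
have h0 : 0 < h by rewrite lt_min ltr01 divr_gt0// mulr_gt0.
have h1 : h <= 1 by rewrite ge_min lexx.
have he : h * (3 * s ^+ 2) <= e by rewrite -ler_pdivlMr ?mulr_gt0// ge_min lexx orbT.
apply: (le_trans (bound h h0)); rewrite -EFinD lee_fin.
have : h ^+ 2 <= h by rewrite expr2 ler_piMr// ltW.
nra.
Qed.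

Lemma integrable_normal_prob_id (s : R) : 0 < s ->
  (normal_prob 0 s).-integrable setT (fun x : R => x%:E).
Proof.
move=> s0; apply/integrableP; split; first exact/measurable_EFinP.
apply: (@le_lt_trans _ _ (\int[normal_prob 0 s]_x (1 + (x ^+ 2)%:E))%E).
  apply: ge0_le_integral => //.
  - by apply: measurableT_comp => //; exact/measurable_EFinP.
  - by apply: emeasurable_funD => //; exact/measurable_EFinP.
  - move=> x _; rewrite -EFinD lee_fin -(real_normK (num_real x)).
    have := sqr_ge0 (`|x| - 1); have := normr_ge0 x; nra.
rewrite ge0_integralD//; last 2 first.
- by move=> x _; rewrite lee_fin sqr_ge0.
- exact/measurable_EFinP.
rewrite integral_cst//= mul1e probability_setT.
by apply: lte_add_pinfty; [exact: ltry|
  exact: le_lt_trans (normal_prob_moment2_le s0) (ltry _)].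
Qed.

(** Reflection preserves Lebesgue measure and the density, and it exchanges the positive and
    negative parts of the identity. Their equal integrals are finite, so they cancel. *)
Lemma normal_prob_mean (s : R) : 0 < s ->
  (\int[normal_prob 0 s]_x x%:E = 0)%E.
Proof.
move=> s0; have /integrable_normal_prob_id idint := s0.
have pdfN x : normal_pdf 0 s (- x) = normal_pdf 0 s x.
  rewrite !normal_pdfE ?gt_eqF//; congr (_ * _).
  by rewrite /normal_fun !subr0 sqrrN.
have mid : measurable_fun setT (fun x : R => x%:E) by exact/measurable_EFinP.
have sym : (\int[normal_prob 0 s]_x (EFin^\+ x)
    = \int[normal_prob 0 s]_x (EFin^\- x))%E.
  rewrite !ge0_integral_normal_prob//; last 2 first.
  - exact: measurable_funeneg.
  - exact: measurable_funepos.
  set f := fun x => (EFin^\+ x * _)%E.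
  transitivity (\int[pushforward mu (-%R : R -> measurableTypeR R)]_x f x)%E.
    by apply: eq_measure_integral => A mA _; exact/esym/lebesgue_measureN.
  rewrite ge0_integral_pushforward//.
  - by apply: eq_integral => x _; rewrite /f /= pdfN funeposE funenegE.
  - apply: emeasurable_funM; first exact: measurable_funepos.
    exact: measurable_EFin_pdf.
  - by move=> x _; rewrite /f mule_ge0 ?lee_fin ?normal_pdf_ge0.
rewrite integralE sym subee//; apply: integrable_neg_fin_num => //.
Qed.

End centered_normal_moments.

Section independent_products.
Context d {T : measurableType d} {R : realType} (P : probability T R).
Context (X Y : T -> R).
Hypothesis mX : measurable_fun setT X.
Hypothesis mY : measurable_fun setT Y.
Hypothesis XY : forall A B : set R, measurable A -> measurable B ->
  P (X @^-1` A `&` Y @^-1` B) = (P (X @^-1` A) * P (Y @^-1` B))%E.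

Let X' : {RV P >-> R} :=
  HB.pack_for {RV P >-> R} X (isMeasurableFun.Build _ _ _ _ _ mX).
Let Y' : {RV P >-> R} :=
  HB.pack_for {RV P >-> R} Y (isMeasurableFun.Build _ _ _ _ _ mY).

Let mXY : measurable_fun setT (fun w => (X w, Y w)).
Proof. exact: measurable_fun_pair. Qed.
Let XY' : {RV P >-> (R * R)%type} :=
  HB.pack_for {RV P >-> (R * R)%type}
   (fun w => (X w, Y w)) (isMeasurableFun.Build _ _ _ _ _ mXY).

(** The hypothesis [XY] is agreement on rectangles, which determines the product measure.
    Expectations of products then become iterated integrals. *)
Let lawXY A : measurable A ->
  (distribution P X' \x distribution P Y')%E A = distribution P XY' A.
Proof.
apply: product_measure_unique => A1 A2 mA1 mA2.
by rewrite /= /distribution /pushforward -XY.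
Qed.

Let integral_lawXY (h : R * R -> \bar R) :
  (\int[distribution P XY']_z h z =
   \int[distribution P X' \x distribution P Y']_z h z)%E.
Proof. by apply: eq_measure_integral => A mA _; exact/esym/lawXY. Qed.

Lemma ge0_integral_indep (f g : R -> \bar R) :
  measurable_fun setT f -> measurable_fun setT g ->
  (forall x, 0 <= f x)%E -> (forall x, 0 <= g x)%E ->
  (\int[P]_w (f (X w) * g (Y w)) =
   \int[P]_w f (X w) * \int[P]_w g (Y w))%E.
Proof.
move=> mf mg f0 g0.
pose h (z : R * R) := (f z.1 * g z.2)%E.
have mh : measurable_fun setT h.
  by apply: emeasurable_funM; exact: measurableT_comp.
have h0 z : (0 <= h z)%E by rewrite mule_ge0.
rewrite -[LHS]/(\int[P]_w (h \o XY') w)%E -ge0_integral_distribution//.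
rewrite integral_lawXY.
rewrite fubini_tonelli1//.
rewrite -[in RHS](ge0_integral_distribution X' mf)//.
rewrite -[in RHS](ge0_integral_distribution Y' mg)//.
rewrite -ge0_integralZr//; last exact: integral_ge0.
apply: eq_integral => x _; rewrite /fubini_F /h/= ge0_integralZl//.
Qed.

(** The nonnegative case, applied to absolute values, gives [E |X Y| = E |X| E |Y|]. It has to
    precede the signed identity, where Fubini asks for an integrable product. *)
Lemma integrable_indepM :
  P.-integrable setT (EFin \o X) -> P.-integrable setT (EFin \o Y) ->
  P.-integrable setT (EFin \o (X \* Y)).
Proof.
move=> /integrableP[_ iX] /integrableP[_ iY]; apply/integrableP; split.
  exact/measurable_EFinP/measurable_funM.
under eq_integral do rewrite /= normrM EFinM.
rewrite (@ge0_integral_indep (fun x => `|x|%:E) (fun x => `|x|%:E))//.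
- apply: lte_mul_pinfty => //; first exact: integral_ge0.
  by rewrite ge0_fin_numE//; exact: integral_ge0.
- by apply/measurable_EFinP; exact: (measurableT_comp (@normr_measurable R setT)).
- by apply/measurable_EFinP; exact: (measurableT_comp (@normr_measurable R setT)).
Qed.

Lemma integral_indepM :
  P.-integrable setT (EFin \o X) -> P.-integrable setT (EFin \o Y) ->
  (\int[P]_w (X w * Y w)%:E = \int[P]_w (X w)%:E * \int[P]_w (Y w)%:E)%E.
Proof.
move=> iX iY.
pose h (z : R * R) := (z.1 * z.2)%:E.
have mh : measurable_fun setT h.
  by apply/measurable_EFinP; apply: measurable_funM;
    [exact: measurable_fst|exact: measurable_snd].
have ih : (distribution P XY').-integrable setT h.
  by apply: integrable_pushforward => //; exact: integrable_indepM.
have ih' : (distribution P X' \x distribution P Y')%E.-integrable setT h.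
  have /integrableP[_ hoo] := ih; apply/integrableP; split => //.
  by rewrite -integral_lawXY.
rewrite -[LHS]/(\int[P]_w (h \o XY') w)%E -integral_distribution//; last first.
  exact: integrable_indepM.
rewrite integral_lawXY.
rewrite -integral12_prod_meas1//.
have iX' : (distribution P X').-integrable setT (EFin : R -> _).
  exact: integrable_pushforward.
have iY' : (distribution P Y').-integrable setT (EFin : R -> _).
  exact: integrable_pushforward.
have EX : (\int[distribution P X']_x x%:E = \int[P]_w (X w)%:E)%E.
  by apply: integral_distribution => //; exact/measurable_EFinP.
have EY : (\int[distribution P Y']_x x%:E = \int[P]_w (Y w)%:E)%E.
  by apply: integral_distribution => //; exact/measurable_EFinP.
rewrite -EX -EY.
have EYfin : (\int[distribution P Y']_y y%:E)%E \is a fin_num.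
  exact: integrable_fin_num.
rewrite -(fineK EYfin) -integralZr//.
apply: eq_integral => x _; rewrite /fubini_F /h fineK//=.
by under eq_integral do rewrite EFinM; rewrite integralZl.
Qed.

End independent_products.

(** * Borel measurability of the coefficients along the particles *)

(** Good-sets principle: the sets whose preimage lies in [M] form a sigma-algebra. *)
Lemma g_sigma_algebra_preimage {T U : Type} (G : set (set U))
    (M : set (set T)) (f : T -> U) : sigma_algebra setT M ->
  (forall A, G A -> M (f @^-1` A)) -> forall A, <<s G>> A -> M (f @^-1` A).
Proof.
move=> [M0 MC MU] GM; suff : <<s G>> `<=` [set A | M (f @^-1` A)] by [].
apply: smallest_sub => //; split => /=.
- by rewrite preimage_set0.
- by move=> A MA; rewrite setTD preimage_setC -setTD; exact: MC.
- by move=> A MA; rewrite preimage_bigcup; exact: MU.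
Qed.

Section borel_matrices.
Context {R : realType} {p q : nat}.

(** Rational boxes form a countable base. Preimages of open sets thus become countable unions of
    finite intersections of coordinate conditions, and measurability can be checked entry by
    entry. *)
Let box (c : 'M[rat]_(p, q) * rat) : set 'M[R]_(p, q) :=
  [set A | forall i j, `|A i j - ratr (c.1 i j)| < ratr c.2].

Let open_box (U : set 'M[R]_(p, q)) : open U ->
  U = \bigcup_(c in [set c | box c `<=` U]) box c.
Proof.
move=> oU; apply/seteqP; split=> [A UA|A [c cU cA]]; last exact: cU.
have /nbhs_ballP[e/= e0 eU] : nbhs A U by exact: open_nbhs_nbhs.
(* With a center within [r] of [A], every point of the box is within [2 r < e] of [A]. *)
have [r] : exists r : rat, 0 < (ratr r : R) < e / 2.
  have /rat_in_itvoo[r] : 0 < e / 2 by rewrite divr_gt0.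
  by rewrite in_itv/= => ?; exists r.
move=> /andP[r0 re].
have ex (x : R) : {y : rat | `|x - ratr y| < ratr r}.
  apply: cid; have /rat_in_itvoo[y] : x - ratr r < x + ratr r by lra.
  by rewrite in_itv/= -ltr_distl distrC => ?; exists y.
exists (\matrix_(i, j) sval (ex (A i j)), r) => /=; last first.
  by move=> i j; rewrite mxE; exact: (svalP (ex (A i j))).
move=> B /= AB; apply: eU; split=> // i j.
have /= := AB i j; rewrite mxE; have := svalP (ex (A i j)).
set z := sval _; rewrite /ball /= => h1 h2.
rewrite -(subrKA (ratr z)) (le_lt_trans (ler_normD _ _))//.
by rewrite [X in _ + X]distrC; lra.
Qed.

Lemma measurable_fun_bmx {d} {T : measurableType d} (f : T -> bmx R p q) :
  (forall i j, measurable_fun setT (fun w => (f w : 'M[R]_(p, q)) i j)) ->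
  measurable_fun setT f.
Proof.
move=> mf; apply: (@measurability _ _ T (bmx R p q) setT f (@open 'M[R]_(p, q)) erefl).
move=> _ [U oU <-]; rewrite setTI (open_box oU) preimage_bigcup bigcup_mkcond.
apply: countable_bigcupT_measurable => // c; case: ifP => // _.
have -> : f @^-1` box c = \bigcap_(i in [set: 'I_p]) \bigcap_(j in [set: 'I_q])
    [set w | `|(f w : 'M[R]_(p, q)) i j - ratr (c.1 i j)| < ratr c.2].
  by apply/seteqP; split=> w /= H; [move=> i _ j _; exact: H|
    move=> i j; exact: H].
apply: fin_bigcap_measurable => // i _; apply: fin_bigcap_measurable => // j _.
rewrite -[X in measurable X]setTI.
have : measurable_fun setT
    (fun w => `|(f w : 'M[R]_(p, q)) i j - ratr (c.1 i j)|).
  apply: measurableT_comp => //; apply: measurable_funB => //.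
by move=> /(_ measurableT `]-oo, ratr c.2[%classic (measurable_itv _));
  rewrite preimage_itvNyo.
Qed.

End borel_matrices.

Section empirical_continuity.
Context {R : realType} {d N : nat} (hN : (0 < N)%N).
Implicit Types y z : 'I_N -> 'cV[R]_d.

Lemma emp_dirac y (A : set (bvec R d)) :
  emp y A = ((N%:R^-1)%:E * \sum_(i < N) (\1_A (y i))%:E)%E.
Proof.
by rewrite /emp; congr (_ * _)%E; apply: eq_bigr => i _; rewrite diracE indicE.
Qed.

(** A pair of vectors is stored as one column of height [d + d], so that the coupling of two
    empirical measures is the image under [split_col] of an empirical measure. *)
Let split_col (c : bvec R (d + d)) : (bvec R d * bvec R d)%type :=
  (usubmx (c : 'cV[R]_(d + d)), dsubmx (c : 'cV[R]_(d + d))).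

Let measurable_split_col : measurable_fun setT split_col.
Proof.
apply: measurable_fun_pair; apply: measurable_fun_bmx => i j.
- under eq_fun do rewrite mxE.
  exact: (@measurable_coord R (d + d) 1 (lshift d i) j).
- under eq_fun do rewrite mxE.
  exact: (@measurable_coord R (d + d) 1 (rshift d i) j).
Qed.

(* The coupling is the law of (y_I, z_I) for an index I uniform on 'I_N. *)
Lemma W2_empirical_le y z :
  W2 (empirical hN y) (empirical hN z) ^+ 2
    <= N%:R^-1 * \sum_(i < N) enorm (y i - z i) ^+ 2.
Proof.
pose mu : probability _ R := empirical hN (fun i => col_mx (y i) (z i)).
pose X : {RV mu >-> (bvec R d * bvec R d)%type} :=
  HB.pack_for {RV mu >-> (bvec R d * bvec R d)%type} split_col
    (isMeasurableFun.Build _ _ _ _ _ measurable_split_col).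
pose pi : probability _ R := distribution mu X.
have S : coupling (empirical hN y) (empirical hN z) pi.
  move=> A mA.
  by rewrite /pi /distribution /pushforward/= !emp_dirac; split; congr (_ * _)%E;
    apply: eq_bigr => i _; congr (_%:E); rewrite !indicE; congr (_%:R);
    congr nat_of_bool; apply/idP/idP => /[!inE];
    rewrite /setX /= /split_col ?col_mxKu ?col_mxKd; tauto.
set a := (X in _ <= X).
have a0 : 0 <= a.
  by rewrite mulr_ge0 ?invr_ge0// sumr_ge0// => i _; rewrite sqr_ge0.
have mdist : measurable_fun setT (fun x : bvec R d * bvec R d =>
    (enorm ((x.1 : 'cV[R]_d) - (x.2 : 'cV[R]_d)) ^+ 2)%:E).
  apply/measurable_EFinP; under eq_fun do rewrite enorm_sq.
  apply: measurable_sum => i; apply: measurable_funX.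
  under eq_fun do rewrite !mxE.
  apply: measurable_funB.
  - exact: (measurableT_comp (@measurable_coord R d 1 i 0) measurable_fst).
  - exact: (measurableT_comp (@measurable_coord R d 1 i 0) measurable_snd).
have Ea : (\int[pi]_x (enorm ((x.1 : 'cV[R]_d) - (x.2 : 'cV[R]_d)) ^+ 2)%:E = a%:E)%E.
  rewrite /pi ge0_integral_distribution//; last by move=> x; rewrite lee_fin sqr_ge0.
  rewrite (ge0_integral_emp hN)//=.
  - rewrite sumEFin -EFinM; congr (_ * _)%:E.
    by apply: eq_bigr => i _; rewrite col_mxKu col_mxKd.
  - exact: measurableT_comp.
  - by move=> x; rewrite lee_fin sqr_ge0.
rewrite /W2.
set I := ereal_inf _.
have I0 : (0 <= I)%E.
  apply: le_ereal_inf_tmp => _ [g _ <-]; apply: integral_ge0 => x _.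
  by rewrite lee_fin sqr_ge0.
have Ia : (I <= a%:E)%E by apply: ereal_inf_lbound; exists pi.
rewrite sqr_sqrtr ?fine_ge0// -lee_fin fineK//.
by rewrite ge0_fin_numE// (le_lt_trans Ia)// ltry.
Qed.

(** Continuity of the map sending the matrix of particles to particle [j] and the empirical measure:
    by [W2_empirical_le], moving every column by at most [e / 2] moves the measure by at most
    [e / 2]. *)
Lemma open_xmu_empirical (j : 'I_N) (U : set ('cV[R]_d * P2 R d)) :
  open_xmu U -> open [set Y : 'M[R]_(d, N) |
    U (col j Y, empirical hN (fun i => col i Y))].
Proof.
move=> oU; rewrite openE => Y /= /oU[e e0 eU].
apply/nbhs_ballP.
(* Sup distance below [r] gives squared Euclidean distance at most [d r^2 <= (e / 2)^2], because
   [d <= (d + 1)^2]; the [+ 1] keeps the quotient meaningful for [d = 0]. *)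
pose r := e / (2 * (d%:R + 1)).
have d0 : 0 < d%:R + 1 :> R by rewrite ltr_wpDl.
have r0 : 0 < r by rewrite divr_gt0// mulr_gt0.
exists r => //= Z [_ YZ].
have bnd i : enorm (col i Z - col i Y) ^+ 2 <= (e / 2) ^+ 2.
  rewrite enorm_sq.
  apply: (@le_trans _ _ (\sum_(k < d) r ^+ 2)).
    apply: ler_sum => k _; rewrite !mxE -real_normK ?num_real//.
    by rewrite lerXn2r ?nnegrE ?(ltW r0)// distrC ltW//; exact: YZ.
  rewrite sumr_const card_ord -[leLHS]mulr_natl /r.
  have -> : e / (2 * (d%:R + 1)) = e / 2 / (d%:R + 1) :> R by field; rewrite gt_eqF.
  rewrite exprMn mulrCA ler_piMr ?sqr_ge0//.
  rewrite exprVn ler_pdivrMr ?exprn_gt0// mul1r.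
  have := ler0n R d; nra.
have e2 : 0 <= e / 2 by rewrite divr_ge0 ?ltW.
apply: eU.
  rewrite (@le_lt_trans _ _ (e / 2))//; last by lra.
  by rewrite -(@ler_pXn2r _ 2) ?nnegrE// sqrtr_ge0.
rewrite (@le_lt_trans _ _ (e / 2))//; last by lra.
rewrite -(@ler_pXn2r _ 2) ?nnegrE ?sqrtr_ge0//.
apply: (le_trans (W2_empirical_le _ _)).
rewrite ler_pdivrMl ?ltr0n//.
rewrite mulr_natl -[X in _ *+ X]card_ord -sumr_const; apply: ler_sum => i _.
have -> : col i Y - col i Z = - (col i Z - col i Y) by rewrite opprB.
apply: le_trans (bnd i); rewrite !enorm_sq.
by apply: ler_sum => k _; rewrite mxE sqrrN.
Qed.

(** The map factors through the matrix with the particles as columns, along which generators of the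
    sigma-algebra on pairs pull back to open sets. The measurable space is arbitrary because the
    past sigma-algebras are to be plugged in. *)
Lemma measurable_coefficient {p q : nat} (f : 'cV[R]_d -> P2 R d -> 'M[R]_(p, q))
    {disp} {T : measurableType disp} (Y : 'I_N -> T -> bvec R d) (j : 'I_N) :
  borel_measurable_xmu f -> (forall i, measurable_fun setT (Y i)) ->
  measurable_fun setT
    (fun w => f (Y j w) (empirical hN (fun i => Y i w)) : bmx R p q).
Proof.
move=> mf mY _ B mB; rewrite setTI.
have /mf := mB.
apply: (@g_sigma_algebra_preimage _ _ _ measurable
  (fun w => (Y j w : 'cV[R]_d, empirical hN (fun i => Y i w)))).
  exact: sigma_algebra_measurable.
move=> U /(@open_xmu_empirical j) oU.
pose M (w : T) : bmx R d N := \matrix_(a < d, i < N) (Y i w : 'cV[R]_d) a 0.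
have mM : measurable_fun setT M.
  apply: measurable_fun_bmx => a i; under eq_fun do rewrite mxE.
  exact: (measurableT_comp (@measurable_coord R d 1 a 0) (mY i)).
have /(mM measurableT) := @sub_sigma_algebra _ setT (@open 'M[R]_(d, N)) _ oU.
rewrite setTI.
have colM i w : col i (M w : 'M[R]_(d, N)) = Y i w.
  by apply/matrixP => a k; rewrite !mxE ord1.
have colsM w : (fun i => col i (M w : 'M[R]_(d, N))) = Y^~ w.
  by apply/funext => i; exact: colM.
by congr measurable; apply/seteqP; split=> w /=; rewrite colM colsM.
Qed.

End empirical_continuity.

(** * Independence of the increments from the past *)

Section past_of_the_particles.
Context {R : realType} {disp : measure_display} {T : measurableType disp}
  (P : probability T R) (F : R -> set (set T)) (hF : usual_filtration P F).
Context {d m N : nat} (W : R -> T -> 'cV[R]_m) (hW : brownian_motion P F W).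
Context (X0 : T -> 'cV[R]_d) (X0_meas : measurable_wrt (F 0) X0).
Context (Wc : 'I_N -> R -> T -> 'cV[R]_m) (X0c : 'I_N -> T -> 'cV[R]_d).
Hypothesis hcopies : independent_copies P W X0 Wc X0c.

Let path_gen : set (set (path_space R d m)) :=
  [set C | (exists2 A : set 'cV[R]_d, @borel_mx R d 1 A & C = [set z | A z.1])
        \/ (exists t : R, 0 <= t /\
             exists2 A : set 'cV[R]_m, @borel_mx R m 1 A &
             C = [set z | A (z.2 t)])].

Definition past_gen (s : R) : set (set (path_space R d m)) :=
  [set C | (exists2 A : set 'cV[R]_d, @borel_mx R d 1 A & C = [set z | A z.1])
        \/ (exists t : R, 0 <= t <= s /\
             exists2 A : set 'cV[R]_m, @borel_mx R m 1 A &
             C = [set z | A (z.2 t)])].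

(* A pi-system generating the sigma-algebra of the initial conditions and of
   the noises of all the particles up to time s. *)
Definition past_rect (s : R) : set (set T) :=
  [set E | exists C : 'I_N -> set (path_space R d m),
    (forall i, <<s past_gen s>> (C i)) /\
    E = [set w | forall i, C i (path_elt (Wc i) (X0c i) w)]].

(** The sample space with a smaller sigma-algebra: dependence on the past only is then plain
    [measurable_fun] out of [past s]. *)
Definition past (s : R) := g_sigma_algebraType (past_rect s).

Let sub_past_path s C : <<s past_gen s>> C -> path_sigma C.
Proof.
apply: sub_sigma_algebra2 => D [hD|[t [/andP[t0 _] hD]]]; first by left.
by right; exists t.
Qed.

(** This concerns the original pair, which is adapted to [F], whereas the copies need not be. Past
    events of the copies are related to [F] only through equality of laws. *)
Let past_F s C : 0 <= s -> <<s past_gen s>> C ->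
  F s (path_elt W X0 @^-1` C).
Proof.
move=> s0; apply: g_sigma_algebra_preimage; first exact: uf_sigma hF _ s0.
move=> _ [[A mA ->]|[t [/andP[t0 ts] [A mA ->]]]].
- by apply: (uf_mono hF _ s0) => //; exact: X0_meas.
- by apply: (uf_mono hF t0 ts); exact: (bm_adapted hW).
Qed.

Let PS := g_sigma_algebraType path_gen.

(** Makes the increment event an event of path space, to which [ic_law] and [ic_measurable]
    apply. *)
Let measurable_increment_path s t (B : set 'cV[R]_m) : 0 <= s -> 0 <= t ->
  @borel_mx R m 1 B -> path_sigma [set z : path_space R d m | B (z.2 t - z.2 s)].
Proof.
move=> s0 t0 mB.
have mproj u : 0 <= u -> measurable_fun setT (fun z : PS => z.2 u : bvec R m).
  move=> u0 _ A mA; rewrite setTI; apply: sub_sigma_algebra; right.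
  by exists u; split => //; exists A.
have : measurable_fun setT (fun z : PS => z.2 t - z.2 s : bvec R m).
  apply: measurable_fun_bmx => i j; rewrite (ord1 j).
  apply: (eq_measurable_fun (fun z : PS => z.2 t i 0 - z.2 s i 0)).
    by move=> z _; rewrite !mxE.
  apply: measurable_funB.
  - exact: (measurableT_comp (@measurable_coord R m 1 i 0) (mproj _ t0)).
  - exact: (measurableT_comp (@measurable_coord R m 1 i 0) (mproj _ s0)).
by move=> /(_ measurableT B mB); rewrite setTI.
Qed.

Lemma setI_closed_past_rect s : setI_closed (past_rect s).
Proof.
move=> _ _ [C [mC ->]] [D [mD ->]]; exists (fun i => C i `&` D i); split.
  by move=> i; apply: (@measurableI _ (g_sigma_algebraType (past_gen s)));
    [exact: mC|exact: mD].
by apply/seteqP; split=> w /= => [[Cw Dw] i|CDw]; [|split=> i; have [] := CDw i].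
Qed.

Lemma past_measurable s A : <<s past_rect s>> A -> measurable A.
Proof.
apply: (@smallest_sub _ (sigma_algebra setT)); first exact: sigma_algebra_measurable.
move=> _ [C [mC ->]].
have -> : [set w | forall i, C i (path_elt (Wc i) (X0c i) w)] =
    \bigcap_(i in [set: 'I_N]) (path_elt (Wc i) (X0c i) @^-1` C i).
  by apply/seteqP; split=> w /= H i; [move=> _|]; exact: H.
apply: fin_bigcap_measurable => // i _.
by apply: (ic_measurable hcopies); exact: (sub_past_path (mC i)).
Qed.

Lemma past_initial s (j : 'I_N) :
  measurable_fun setT (X0c j : past s -> bvec R d).
Proof.
move=> _ A mA; rewrite setTI; apply: sub_sigma_algebra.
exists (fun i => if i == j then [set z | A z.1] else setT); split.
  move=> i; case: ifP => _; last first.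
    exact: (@measurableT _ (g_sigma_algebraType (past_gen s))).
  by apply: sub_sigma_algebra; left; exists A.
apply/seteqP; split=> w /= => [Aw i|/(_ j)]; last by rewrite eqxx.
by case: eqP => [->|].
Qed.

Lemma past_noise s t (j : 'I_N) : 0 <= t <= s ->
  measurable_fun setT (Wc j t : past s -> bvec R m).
Proof.
move=> t0s _ A mA; rewrite setTI; apply: sub_sigma_algebra.
exists (fun i => if i == j then [set z | A (z.2 t)] else setT); split.
  move=> i; case: ifP => _; last first.
    exact: (@measurableT _ (g_sigma_algebraType (past_gen s))).
  by apply: sub_sigma_algebra; right; exists t; split => //; exists A.
apply/seteqP; split=> w /= => [Aw i|/(_ j)]; last by rewrite eqxx.
by case: eqP => [->|].
Qed.

Lemma measurable_past {d'} {U : measurableType d'} s (f : T -> U) :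
  measurable_fun setT (f : past s -> U) -> measurable_fun setT f.
Proof.
move=> mf _ A mA; rewrite setTI; apply: (@past_measurable s).
by rewrite -[X in <<s _ >> X]setTI; exact: mf.
Qed.

Let increment_law s t j B : 0 <= s -> 0 <= t -> @borel_mx R m 1 B ->
  P [set w | B (Wc j t w - Wc j s w)] = P [set w | B (W t w - W s w)].
Proof.
by move=> s0 t0 mB; exact: (ic_law hcopies j (measurable_increment_path s0 t0 mB)).
Qed.

(** Intersecting a rectangle with an increment event of particle [j] changes its side [j] only, so
    [ic_indep] leaves a single factor to compare. That factor involves one copy; [ic_law] turns it
    into an event of [(W, X0)], where [bm_indep] applies. *)
Let increment_rect_indep s t j B E : 0 <= s -> s < t -> @borel_mx R m 1 B ->
  past_rect s E ->
  (P (E `&` [set w | B (Wc j t w - Wc j s w)%R]) =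
   P E * P [set w | B (Wc j t w - Wc j s w)%R])%E.
Proof.
move=> s0 st mB [C [mC ->]].
have t0 : 0 <= t by rewrite (le_trans s0)// ltW.
have mD := measurable_increment_path s0 t0 mB.
pose C' i := if i == j then C j `&` [set z | B (z.2 t - z.2 s)] else C i.
have mC' i : path_sigma (C' i).
  rewrite /C'; case: ifP => _; last exact: sub_past_path (mC i).
  by apply: (@measurableI _ PS) => //; exact: sub_past_path (mC j).
have -> : [set w | forall i, C i (path_elt (Wc i) (X0c i) w)] `&`
    [set w | B (Wc j t w - Wc j s w)] =
    [set w | forall i, C' i (path_elt (Wc i) (X0c i) w)].
  apply/seteqP; split=> w /=.
    by move=> [Cw Bw] i; rewrite /C'; case: eqP => [->|]//; split => //; exact: Cw.
  move=> Cw; split=> [i|]; last by have := Cw j; rewrite /C' eqxx => -[].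
  by have := Cw i; rewrite /C'; case: eqP => [->[]|].
rewrite (ic_indep hcopies mC') (ic_indep hcopies (fun i => sub_past_path (mC i))).
rewrite (bigD1 j)//= [in RHS](bigD1 j)//= increment_law//.
rewrite [in RHS]muleAC; congr (_ * _)%E; last first.
  by apply: eq_bigr => i /negbTE ij; rewrite /C' ij.
rewrite !(ic_law hcopies)//; last exact: sub_past_path (mC j).
rewrite /C' eqxx preimage_setI.
exact: (bm_indep hW s0 st (past_F s0 (mC j)) mB).
Qed.

(** For a fixed increment event, the events satisfying the product rule form a Dynkin system, which
    contains the pi-system of rectangles. *)
Lemma increment_past_indep s t j B E : 0 <= s -> s < t -> @borel_mx R m 1 B ->
  <<s past_rect s>> E ->
  (P (E `&` [set w | B (Wc j t w - Wc j s w)%R]) =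
   P E * P [set w | B (Wc j t w - Wc j s w)%R])%E.
Proof.
move=> s0 st mB; set D := [set w | _].
have mD : measurable D.
  apply: (ic_measurable hcopies j (C := [set z | B (z.2 t - z.2 s)])).
  by apply: measurable_increment_path => //; rewrite (le_trans s0)// ltW.
move: E; apply: (@dynkin_induction _ (past s) (past_rect s)
  (fun E => (P (E `&` D) = P E * P D)%E)) => //.
- exact: setI_closed_past_rect.
- by rewrite setTI probability_setT mul1e.
- by move=> E rE; exact: increment_rect_indep.
- move=> E mE IH; have mE' := past_measurable mE.
  have {}IH : (P (D `&` E) = P E * P D)%E by rewrite setIC; exact: IH.
  have -> : (P (~` E `&` D) = P D - P (D `&` E))%E.
    by rewrite setIC -setDE measureD// (le_lt_trans (probability_le1 _ _)) ?ltry.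
  rewrite probability_setC// IH.
  rewrite -(fineK (fin_num_measure P _ mE')) -(fineK (fin_num_measure P _ mD)).
  by rewrite -EFinM -!EFinB -EFinM mulrBl mul1r.
- move=> E mE tE IH; rewrite setI_bigcupl.
  have mE' n := past_measurable (mE n).
  have mED n : disp.-measurable (E n `&` D).
    by apply: (@measurableI _ T); [exact: mE'|exact: mD].
  have -> : P (\bigcup_n (E n `&` D)) = (\sum_(n <oo) P (E n `&` D))%E.
    apply: measure_semi_bigcup => //; first exact: trivIset_setIr.
    exact: bigcupT_measurable.
  have -> : P (\bigcup_n E n) = (\sum_(n <oo) P (E n))%E.
    by apply: measure_semi_bigcup => //; exact: bigcupT_measurable.
  rewrite muleC -(fineK (fin_num_measure P _ mD)) -nneseriesZl//.
  by apply: eq_eseriesr => n _; rewrite IH muleC fineK// fin_num_measure.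
Qed.

(** In the product over coordinates of the Gaussian law, every coordinate other than [l] is given
    the full line and contributes 1. *)
Lemma increment_normal s t j l (A : set R) : 0 <= s -> s < t -> measurable A ->
  P [set w | A ((Wc j t w - Wc j s w) l 0)] = normal_prob 0 (Num.sqrt (t - s)) A.
Proof.
move=> s0 st mA.
have mB : @borel_mx R m 1 [set x | A (x l 0)].
  by have := @measurable_coord R m 1 l 0 measurableT A mA; rewrite setTI.
have t0 : 0 <= t by rewrite (le_trans s0)// ltW.
rewrite (increment_law j s0 t0 mB).
pose A' i := if i == l then A else setT.
have mA' i : measurable (A' i) by rewrite /A'; case: ifP.
have -> : [set w | [set x : 'cV[R]_m | A (x l 0)] (W t w - W s w)] =
    [set w | forall i, A' i ((W t w - W s w) i 0)].
  apply/seteqP; split=> w /= => [Aw i|/(_ l)]; last by rewrite /A' eqxx.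
  by rewrite /A'; case: eqP => [->|].
rewrite (bm_gauss hW s0 st mA') (bigD1 l)//= big1 ?mule1 /A' ?eqxx//.
by move=> i /negbTE ->; exact: probability_setT.
Qed.

End past_of_the_particles.

(** * The second moment of the scheme *)

Section vector_inequalities.
Context {R : realType} {d m : nat}.
Implicit Types (x y : 'cV[R]_d) (s : 'M[R]_(d, m)) (v : 'cV[R]_m).

Lemma fnorm_sq s : fnorm s ^+ 2 = \sum_(i < d) \sum_(j < m) s i j ^+ 2.
Proof.
rewrite sqr_sqrtr// sumr_ge0// => i _; apply: sumr_ge0 => j _; exact: sqr_ge0.
Qed.

Lemma enormD_sq x y :
  enorm (x + y) ^+ 2 = enorm x ^+ 2 + 2 * dotv x y + enorm y ^+ 2.
Proof.
rewrite !enorm_sq /dotv mulr_sumr -!big_split; apply: eq_bigr => i _ /=.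
by rewrite mxE; ring.
Qed.

Lemma enormZ_sq (c : R) x : enorm (c *: x) ^+ 2 = c ^+ 2 * enorm x ^+ 2.
Proof.
by rewrite !enorm_sq mulr_sumr; apply: eq_bigr => i _; rewrite mxE exprMn.
Qed.

Lemma dotvZr (c : R) x y : dotv x (c *: y) = c * dotv x y.
Proof. by rewrite /dotv mulr_sumr; apply: eq_bigr => i _; rewrite mxE mulrCA. Qed.

(** Lagrange's identity: after symmetrizing in [i] and [j], twice the difference of the two sides is
    the double sum of [(f i * g j - f j * g i)^2]. *)
Lemma cauchy_schwarz_sum n (f g : 'I_n -> R) :
  (\sum_i f i * g i) ^+ 2 <= (\sum_i f i ^+ 2) * (\sum_i g i ^+ 2).
Proof.
rewrite -subr_ge0 expr2 !big_distrlr/= -sumrB.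
under eq_bigr do rewrite -sumrB.
have E : \sum_i \sum_j (f i ^+ 2 * g j ^+ 2 - f i * g i * (f j * g j))
    = \sum_i \sum_j (f j ^+ 2 * g i ^+ 2 - f i * g i * (f j * g j)).
  rewrite exchange_big; apply: eq_bigr => i _; apply: eq_bigr => j _; ring.
rewrite -(@pmulr_rge0 _ 2)// mulr2n mulrDl mul1r {2}E -big_split.
apply: sumr_ge0 => i _; rewrite -big_split; apply: sumr_ge0 => j _ /=.
by rewrite [leRHS](_ : _ = (f i * g j - f j * g i) ^+ 2) ?sqr_ge0//; ring.
Qed.

Lemma enorm_mulmx_sq_le s v : enorm (s *m v) ^+ 2 <= fnorm s ^+ 2 * enorm v ^+ 2.
Proof.
rewrite !enorm_sq fnorm_sq mulr_suml; apply: ler_sum => i _.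
by rewrite mxE; exact: cauchy_schwarz_sum.
Qed.

Lemma dotv_mulmx x s v :
  dotv x (s *m v) = \sum_(l < m) (\sum_(i < d) x i 0 * s i l) * v l 0.
Proof.
rewrite /dotv; under eq_bigr do rewrite mxE mulr_sumr.
rewrite exchange_big; apply: eq_bigr => l _; rewrite mulr_suml.
by apply: eq_bigr => i _; rewrite mulrA.
Qed.

(** A crude domination, used to integrate the coefficient of one noise coordinate in the cross
    term. *)
Lemma sum_col_le x s l :
  `|\sum_(i < d) x i 0 * s i l| <= enorm x ^+ 2 + fnorm s ^+ 2.
Proof.
rewrite enorm_sq fnorm_sq -big_split; apply: le_trans (ler_norm_sum _ _ _) _.
apply: ler_sum => i _ /=.
apply: (@le_trans _ _ (x i 0 ^+ 2 + s i l ^+ 2)).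
  rewrite normrM -(real_normK (num_real (x i 0))) -(real_normK (num_real (s i l))).
  have := sqr_ge0 (`|x i 0| - `|s i l|); have := normr_ge0 (x i 0).
  have := normr_ge0 (s i l); nra.
by rewrite lerD2l (bigD1 l)//= lerDl sumr_ge0// => j _; exact: sqr_ge0.
Qed.

End vector_inequalities.

(** * One step driven by noise independent of the past *)

Section one_step.
Context {R : realType} {disp : measure_display} {T : measurableType disp}
  (P : probability T R) (G : set (set T)) {d m : nat}.
Context (a : T -> 'cV[R]_d) (s : T -> 'M[R]_(d, m)) (xi : T -> 'cV[R]_m) (D : R).
Hypothesis D0 : 0 < D.
Hypothesis Gm : forall A, <<s G>> A -> measurable A.
Hypothesis ma : measurable_fun setT (a : g_sigma_algebraType G -> bvec R d).
Hypothesis ms : measurable_fun setT (s : g_sigma_algebraType G -> bmx R d m).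
Hypothesis mxi : measurable_fun setT (xi : T -> bvec R m).
Hypothesis xi_indep : forall (l : 'I_m) A B, <<s G>> A -> measurable B ->
  P (A `&` [set w | B (xi w l 0)]) = (P A * P [set w | B (xi w l 0)%R])%E.
Hypothesis xi_normal : forall (l : 'I_m) B, measurable B ->
  P [set w | B (xi w l 0)] = normal_prob 0 (Num.sqrt D) B.

Let mxil l : measurable_fun setT (fun w => xi w l 0).
Proof. exact: (measurableT_comp (@measurable_coord R m 1 l 0) mxi). Qed.

Let mxil' l : measurable_fun setT ((fun w => xi w l 0) : T -> measurableTypeR R).
Proof. exact: mxil. Qed.

Let xil l : {RV P >-> measurableTypeR R} :=
  HB.pack_for {RV P >-> measurableTypeR R} (fun w => xi w l 0)
  (isMeasurableFun.Build _ _ _ _ _ (@mxil' l)).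

Let integral_xil l (f : R -> \bar R) :
  (\int[distribution P (xil l)]_x f x = \int[normal_prob 0 (Num.sqrt D)]_x f x)%E.
Proof. by apply: eq_measure_integral => A mA _; exact: xi_normal. Qed.

Let sqrtD0 : 0 < Num.sqrt D. Proof. by rewrite sqrtr_gt0. Qed.

Let xi_moment2 l : (\int[P]_w (xi w l 0 ^+ 2)%R%:E <= D%:E)%E.
Proof.
have <- : (\int[distribution P (xil l)]_x (x ^+ 2)%:E
    = \int[P]_w (xi w l 0 ^+ 2)%R%:E)%E.
  apply: ge0_integral_distribution; last by move=> x; rewrite lee_fin sqr_ge0.
  by apply/measurable_EFinP; exact: measurable_funX.
rewrite integral_xil -[in leRHS](sqr_sqrtr (ltW D0)).
exact: normal_prob_moment2_le.
Qed.

Let xi_integrable l : P.-integrable setT (fun w => (xi w l 0)%R%:E).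
Proof.
apply/integrableP; split; first exact/measurable_EFinP.
have <- : (\int[distribution P (xil l)]_x `|x%:E|
    = \int[P]_w `|(xi w l 0)%R%:E|)%E.
  apply: ge0_integral_distribution => //.
  by apply: measurableT_comp => //; exact/measurable_EFinP.
rewrite integral_xil.
by have /integrableP[] := integrable_normal_prob_id sqrtD0.
Qed.

Let xi_mean l : (\int[P]_w (xi w l 0)%R%:E = 0)%E.
Proof.
have <- : (\int[distribution P (xil l)]_x x%:E = \int[P]_w (xi w l 0)%R%:E)%E.
  apply: integral_distribution; last exact: xi_integrable.
  exact/measurable_EFinP.
by rewrite integral_xil normal_prob_mean.
Qed.

Let Gmeas {d'} {U : measurableType d'} (f : T -> U) :
  measurable_fun setT (f : g_sigma_algebraType G -> U) -> measurable_fun setT f.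
Proof.
move=> mf _ A mA; rewrite setTI; apply: Gm.
by rewrite -[X in <<s _ >> X]setTI; exact: mf.
Qed.

Let indepG (X : T -> R) l : measurable_fun setT (X : g_sigma_algebraType G -> R) ->
  forall A B : set R, measurable A -> measurable B ->
  P (X @^-1` A `&` (fun w => xi w l 0) @^-1` B)
  = (P (X @^-1` A) * P ((fun w => (xi w l 0)%R) @^-1` B))%E.
Proof.
move=> mX A B mA mB; apply: xi_indep => //.
by rewrite -[X in <<s _ >> X]setTI; exact: mX.
Qed.

Let Z l w := \sum_(i < d) a w i 0 * s w i l.

Let mZ l : measurable_fun setT (Z l : g_sigma_algebraType G -> R).
Proof.
apply: measurable_sum => i; apply: measurable_funM.
- exact: (measurableT_comp (@measurable_coord R d 1 i 0) ma).
- exact: (measurableT_comp (@measurable_coord R d m i l) ms).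
Qed.

Let mfnorm : measurable_fun setT
  ((fun w => fnorm (s w) ^+ 2) : g_sigma_algebraType G -> R).
Proof.
under eq_fun do rewrite fnorm_sq.
apply: measurable_sum => i; apply: measurable_sum => j; apply: measurable_funX.
exact: (measurableT_comp (@measurable_coord R d m i j) ms).
Qed.

Let menorm : measurable_fun setT (fun w => enorm (a w) ^+ 2).
Proof.
by apply: Gmeas; exact: (measurableT_comp (@measurable_enorm_sq R d) ma).
Qed.

Hypothesis ia : P.-integrable setT (fun w => (enorm (a w) ^+ 2)%:E).
Hypothesis ifs : P.-integrable setT (fun w => (fnorm (s w) ^+ 2)%:E).

Let iZ l : P.-integrable setT (EFin \o Z l).
Proof.
apply: (le_integrable _ _ _ (integrableD _ ia ifs)) => //.
  by apply/measurable_EFinP; exact: Gmeas (mZ l).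
move=> w _ /=; rewrite lee_fin; apply: le_trans (sum_col_le _ _ _) _.
exact: ler_norm.
Qed.

(** By [dotv_mulmx] the cross term is a sum over noise coordinates, each a centered variable times
    an integrable coefficient [Z l] known from the past. Integrability comes along because this
    signed term must later be split off an integral. *)
Let cross_zero : P.-integrable setT (fun w => (2 * dotv (a w) (s w *m xi w))%:E) /\
  (\int[P]_w (2 * dotv (a w) (s w *m xi w))%:E = 0)%E.
Proof.
have E w : (2 * dotv (a w) (s w *m xi w))%:E
    = (2%:E * \sum_(l < m) (Z l w * xi w l 0)%R%:E)%E.
  by rewrite dotv_mulmx EFinM sumEFin.
under eq_fun do rewrite E.
have iZxi l : P.-integrable setT (fun w => (Z l w * xi w l 0)%R%:E).
  exact: (@integrable_indepM _ _ _ P (Z l) (fun w => (xi w l 0)%R)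
    (Gmeas (mZ l)) (@mxil l) (@indepG (Z l) l (mZ l)) (iZ l) (@xi_integrable l)).
have isum : P.-integrable setT (fun w => (\sum_(l < m) (Z l w * xi w l 0)%R%:E)%E).
  exact: integrable_sum.
split; first exact: integrableZl.
rewrite integralZl// integral_sum// big1 ?mule0// => l _.
rewrite (@integral_indepM _ _ _ P (Z l) (fun w => (xi w l 0)%R)
    (Gmeas (mZ l)) (@mxil l) (@indepG (Z l) l (mZ l)) (iZ l) (@xi_integrable l)).
by rewrite xi_mean mule0.
Qed.

(* Dominates [enorm (s w *m xi w) ^+ 2] by Cauchy-Schwarz, so that the
   correlations between the coordinates of [xi] are irrelevant. *)
Let noise w := \sum_(l < m) (fnorm (s w) ^+ 2 * xi w l 0 ^+ 2).

Let mnoise : measurable_fun setT noise.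
Proof.
by apply: measurable_sum => l; apply: measurable_funM;
    [exact: Gmeas|exact: measurable_funX].
Qed.

Let noise_ge0 w : 0 <= noise w.
Proof. by apply: sumr_ge0 => l _; rewrite mulr_ge0 ?sqr_ge0. Qed.

(** Independence splits each summand into [E |s|^2] times a second moment at most [D]; the [m]
    summands give the factor [D * m]. *)
Let noise_le :
  (\int[P]_w (noise w)%:E <= (D * m%:R)%:E * \int[P]_w (fnorm (s w) ^+ 2)%:E)%E.
Proof.
under eq_integral do rewrite /noise -sumEFin.
rewrite ge0_integral_sum//; last 2 first.
- by move=> l; apply/measurable_EFinP; apply: measurable_funM;
    [exact: Gmeas|exact: measurable_funX].
- by move=> l w _; rewrite lee_fin mulr_ge0 ?sqr_ge0.
apply: (@le_trans _ _ (\sum_(l < m) D%:E * \int[P]_w (fnorm (s w) ^+ 2)%:E)%E).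
  apply: lee_sum => l _.
  (* [ge0_integral_indep] needs a function nonnegative on the whole line, so the identity is
     replaced by the absolute value. *)
  under eq_integral do rewrite -(ger0_norm (sqr_ge0 (fnorm (s _)))) EFinM.
  rewrite (@ge0_integral_indep _ _ _ P (fun w => fnorm (s w) ^+ 2) (fun w => (xi w l 0)%R)
    (Gmeas mfnorm) (@mxil l) (@indepG _ l mfnorm)
    (fun x => `|x|%:E) (fun x => (x ^+ 2)%:E)) //; last 3 first.
  - by apply/measurable_EFinP; exact: normr_measurable.
  - by apply/measurable_EFinP; exact: measurable_funX.
  - by move=> x; rewrite lee_fin sqr_ge0.
  under eq_integral do rewrite ger0_norm ?sqr_ge0//.
  rewrite muleC lee_wpmul2r//; first
    by apply: integral_ge0 => w _; rewrite lee_fin sqr_ge0.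
rewrite sumr_const card_ord -[leLHS]mule_natl muleA -EFinM mulrC.
exact: lexx.
Qed.

Lemma one_step_moment2_le :
  (\int[P]_w (enorm (a w + s w *m xi w) ^+ 2)%:E <=
   \int[P]_w (enorm (a w) ^+ 2 + D * m%:R * fnorm (s w) ^+ 2)%:E)%E.
Proof.
have [ic c0] := cross_zero.
have inoise : P.-integrable setT (fun w => (noise w)%:E).
  apply/integrableP; split; first exact/measurable_EFinP.
  under eq_integral do rewrite gee0_abs ?lee_fin//.
  apply: (le_lt_trans noise_le); apply: lte_mul_pinfty => //.
    by rewrite lee_fin mulr_ge0// ltW.
  have /integrableP[_] := ifs.
  by under eq_integral do rewrite gee0_abs ?lee_fin ?sqr_ge0//.
have iD := integrableD measurableT ia inoise.
(* The squared noise is bounded pointwise, while the cross term is kept exactly, since it vanishes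
   only after integration. *)
apply: (@le_trans _ _ (\int[P]_w ((enorm (a w) ^+ 2)%:E + (noise w)%:E
    + (2 * dotv (a w) (s w *m xi w))%:E))%E).
  apply: ge0_le_integral => //.
  - by move=> w _; rewrite lee_fin sqr_ge0.
  - apply/measurable_EFinP.
    apply: (measurableT_comp (@measurable_enorm_sq R d)).
    apply: measurable_fun_bmx => i j; rewrite (ord1 j).
    apply: (eq_measurable_fun (fun w => a w i 0 + \sum_l s w i l * xi w l 0)).
      by move=> w _; rewrite !mxE.
    apply: measurable_funD.
      exact: (measurableT_comp (@measurable_coord R d 1 i 0) (Gmeas ma)).
    apply: measurable_sum => l; apply: measurable_funM => //.
    exact: (measurableT_comp (@measurable_coord R d m i l) (Gmeas ms)).
  - by apply: emeasurable_funD; [exact: measurable_int iD|exact: measurable_int ic].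
  - move=> w _; rewrite -!EFinD lee_fin enormD_sq.
    rewrite [leRHS]addrAC lerD2l; apply: le_trans (enorm_mulmx_sq_le _ _) _.
    by rewrite enorm_sq mulr_sumr.
rewrite integralD// c0 adde0 ge0_integralD//; last 4 first.
- by move=> w _; rewrite lee_fin sqr_ge0.
- exact/measurable_EFinP.
- by move=> w _; rewrite lee_fin.
- exact/measurable_EFinP.
under [leRHS]eq_integral do rewrite EFinD.
have cD : 0 <= D * m%:R by rewrite mulr_ge0// ltW.
rewrite ge0_integralD//; last 4 first.
- by move=> w _; rewrite lee_fin sqr_ge0.
- exact/measurable_EFinP.
- by move=> w _; rewrite lee_fin mulr_ge0 ?sqr_ge0.
- by apply/measurable_EFinP; apply: measurable_funM => //; exact: Gmeas.
apply: leeD => //; apply: le_trans noise_le _.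
under [leRHS]eq_integral do rewrite EFinM.
rewrite ge0_integralZl//.
- by apply/measurable_EFinP; exact: Gmeas.
- by move=> w _; rewrite lee_fin sqr_ge0.
Qed.

End one_step.

Lemma moment2_empirical {R : realType} {d N : nat} (hN : (0 < N)%N)
    (y : 'I_N -> 'cV[R]_d) :
  moment2 (empirical hN y) ^+ 2 = N%:R^-1 * \sum_(i < N) enorm (y i) ^+ 2.
Proof.
rewrite /moment2 (ge0_integral_emp hN).
- rewrite sumEFin -EFinM sqr_sqrtr// mulr_ge0 ?invr_ge0// sumr_ge0// => i _.
  exact: sqr_ge0.
- by apply/measurable_EFinP; exact: measurable_enorm_sq.
- by move=> x; rewrite lee_fin sqr_ge0.
Qed.

(** * Moments of the particle system *)

Section euler_moments.
Context {R : realType} {disp : measure_display} {T : measurableType disp}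
  (P : probability T R) (F : R -> set (set T)) (hF : usual_filtration P F).
Context {d m N : nat} (hm : (0 < m)%N) (hN : (0 < N)%N).
Context (b : 'cV[R]_d -> P2 R d -> 'cV[R]_d)
  (sigma : 'cV[R]_d -> P2 R d -> 'M[R]_(d, m)).
Hypothesis b_meas : borel_measurable_xmu b.
Hypothesis sigma_meas : borel_measurable_xmu sigma.
Context (W : R -> T -> 'cV[R]_m) (hW : brownian_motion P F W).
Context (X0 : T -> 'cV[R]_d) (X0_meas : measurable_wrt (F 0) X0).
Context (Wc : 'I_N -> R -> T -> 'cV[R]_m) (X0c : 'I_N -> T -> 'cV[R]_d).
Hypothesis hcopies : independent_copies P W X0 Wc X0c.
Context (b1 b2 c1 c2 : R).
Hypothesis hii : forall (x : 'cV[R]_d) (mu : P2 R d),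
  enorm (b x mu) ^+ 2 <= b1 * enorm x ^+ 2 + b2 * moment2 mu ^+ 2.
Hypothesis hiii : forall (x : 'cV[R]_d) (mu : P2 R d),
  2 * dotv x (b x mu) + m%:R * fnorm (sigma x mu) ^+ 2
    <= - c1 * enorm x ^+ 2 + c2 * moment2 mu ^+ 2.
Hypothesis c1_gt0 : 0 < c1.
Hypothesis X0_moment2 : (\int[P]_w (enorm (X0 w) ^+ 2)%:E < +oo)%E.
Context (D : R).
Hypothesis D0 : 0 < D.

Let Y k (j : 'I_N) (w : T) : 'cV[R]_d := euler b sigma hN D Wc X0c k j w.
Let mu k w := empirical hN (fun i => Y k i w).
Let a k j w := Y k j w + D *: b (Y k j w) (mu k w).
Let s k j w := sigma (Y k j w) (mu k w).
Let xi k j w := Wc j (k.+1%:R * D) w - Wc j (k%:R * D) w.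
Let pastT (t : R) := past Wc X0c t.

Let YS k j w : Y k.+1 j w = a k j w + s k j w *m xi k j w.
Proof. by []. Qed.

(** The [S_k] of the overview. By [moment2_mu] it is also the squared moment of the empirical
    measure, so averaging the measure terms of (ii) and (iii) over the particles gives it back. *)
Definition mean_sq k w : R := N%:R^-1 * \sum_(i < N) enorm (Y k i w) ^+ 2.

Let moment2_mu k w : moment2 (mu k w) ^+ 2 = mean_sq k w.
Proof. exact: moment2_empirical. Qed.

Let mean_sq_ge0 k w : 0 <= mean_sq k w.
Proof. by rewrite mulr_ge0 ?invr_ge0// sumr_ge0// => i _; exact: sqr_ge0. Qed.

Let kD_ge0 k : 0 <= k%:R * D. Proof. by rewrite mulr_ge0// ltW. Qed.

Let kDS k : k%:R * D < k.+1%:R * D. Proof. by rewrite ltr_pM2r// ltr_nat. Qed.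

Let measurable_a k t j :
  (forall i, measurable_fun setT (Y k i : pastT t -> bvec R d)) ->
  measurable_fun setT (a k j : pastT t -> bvec R d).
Proof.
move=> mY; apply: measurable_fun_bmx => i l; rewrite (ord1 l).
apply: (eq_measurable_fun
  (fun w : pastT t => Y k j w i 0 + D * b (Y k j w) (mu k w) i 0)).
  by move=> w _; rewrite !mxE.
apply: measurable_funD.
  exact: (measurableT_comp (@measurable_coord R d 1 i 0) (mY j)).
apply: measurable_funM => //.
have mb := @measurable_coefficient R d N hN d 1 b _ (pastT t) (Y k) j b_meas mY.
exact: (measurableT_comp (@measurable_coord R d 1 i 0) mb).
Qed.

Let measurable_s k t j :
  (forall i, measurable_fun setT (Y k i : pastT t -> bvec R d)) ->
  measurable_fun setT (s k j : pastT t -> bmx R d m).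
Proof. by move=> mY; exact: measurable_coefficient. Qed.

Let measurable_xi k t j : k.+1%:R * D <= t ->
  measurable_fun setT (xi k j : pastT t -> bvec R m).
Proof.
move=> kt; apply: measurable_fun_bmx => i l; rewrite (ord1 l).
apply: (eq_measurable_fun
  (fun w : pastT t => Wc j (k.+1%:R * D) w i 0 - Wc j (k%:R * D) w i 0)).
  by move=> w _; rewrite !mxE.
apply: measurable_funB; apply: (measurableT_comp (@measurable_coord R m 1 i 0)).
- by apply: past_noise; rewrite kD_ge0.
- by apply: past_noise; rewrite kD_ge0/= (le_trans _ kt)// ltW.
Qed.

(** The time [t] is left free above [k * D], so that the induction hypothesis for step [k] can be
    used in the past of a later time. *)
Let measurable_Y_past k t j : k%:R * D <= t ->
  measurable_fun setT (Y k j : pastT t -> bvec R d).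
Proof.
elim: k j => [|k IH] j kt; first exact: past_initial.
have mY i : measurable_fun setT (Y k i : pastT t -> bvec R d).
  by apply: IH; rewrite (le_trans _ kt)// ltW.
apply: measurable_fun_bmx => i l; rewrite (ord1 l).
apply: (eq_measurable_fun
  (fun w : pastT t => a k j w i 0 + \sum_l s k j w i l * xi k j w l 0)).
  by move=> w _; rewrite YS !mxE.
apply: measurable_funD.
  exact: (measurableT_comp (@measurable_coord R d 1 i 0) (measurable_a j mY)).
apply: measurable_sum => r; apply: measurable_funM.
  exact: (measurableT_comp (@measurable_coord R d m i r) (measurable_s j mY)).
exact: (measurableT_comp (@measurable_coord R m 1 r 0) (measurable_xi j kt)).
Qed.

Let measurable_past_bvec {p q} t (f : T -> 'M[R]_(p, q)) :
  measurable_fun setT (f : pastT t -> bmx R p q) ->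
  measurable_fun setT (f : T -> bmx R p q).
Proof. exact: (measurable_past hcopies). Qed.

Let measurable_Ysq k j : measurable_fun setT (fun w => (enorm (Y k j w) ^+ 2)%:E).
Proof.
apply/measurable_EFinP; apply: (measurableT_comp (@measurable_enorm_sq R d)).
exact: measurable_past_bvec (measurable_Y_past j (lexx _)).
Qed.

(* Parallelogram law applied to [Y + D b] and [Y - D b]. *)
Let enorm_drift_sq_le k j w :
  enorm (a k j w) ^+ 2 <= (2 + 2 * D ^+ 2 * b1) * enorm (Y k j w) ^+ 2
    + 2 * D ^+ 2 * b2 * mean_sq k w.
Proof.
have h := hii (Y k j w) (mu k w); rewrite moment2_mu in h.
have E : enorm (a k j w) ^+ 2 + enorm (Y k j w + (- D) *: b (Y k j w) (mu k w)) ^+ 2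
    = 2 * enorm (Y k j w) ^+ 2 + 2 * D ^+ 2 * enorm (b (Y k j w) (mu k w)) ^+ 2.
  by rewrite !enormD_sq !dotvZr !enormZ_sq; ring.
have := sqr_ge0 (enorm (Y k j w + (- D) *: b (Y k j w) (mu k w))).
have : D ^+ 2 * enorm (b (Y k j w) (mu k w)) ^+ 2 <=
   D ^+ 2 * (b1 * enorm (Y k j w) ^+ 2 + b2 * mean_sq k w).
  by rewrite ler_wpM2l ?sqr_ge0.
lra.
Qed.

(** In (iii) the inner product is absorbed by [- 2 <x, b> <= |x|^2 + |b|^2], then (ii) bounds
    [|b|^2]; the factor [m >= 1] and the term in [c1] are dropped. *)
Let fnorm_sigma_sq_le k j w :
  fnorm (s k j w) ^+ 2 <= (1 + b1) * enorm (Y k j w) ^+ 2 + (c2 + b2) * mean_sq k w.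
Proof.
have h := hii (Y k j w) (mu k w); have h' := hiii (Y k j w) (mu k w).
rewrite moment2_mu -/(s k j w) in h h'.
have m1 : fnorm (s k j w) ^+ 2 <= m%:R * fnorm (s k j w) ^+ 2.
  by rewrite ler_peMl ?sqr_ge0// ler1n.
have E := enormD_sq (Y k j w) (b (Y k j w) (mu k w)).
have := sqr_ge0 (enorm (Y k j w + b (Y k j w) (mu k w))).
have : 0 <= c1 * enorm (Y k j w) ^+ 2 by rewrite mulr_ge0 ?sqr_ge0// ltW.
lra.
Qed.

(** The copy starts from a variable with the law of [X0]: [ic_law] is applied to events on the
    initial coordinate. *)
Let initial_moment2_lty j : (\int[P]_w (enorm (Y 0 j w) ^+ 2)%:E < +oo)%E.
Proof.
have mX0 : measurable_fun setT (X0 : T -> bvec R d).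
  by move=> _ B mB; rewrite setTI; apply: (uf_sub hF (lexx 0)); exact: X0_meas.
have mY0 : measurable_fun setT (Y 0 j : T -> bvec R d).
  exact: measurable_past_bvec (measurable_Y_past j (lexx _)).
pose f (x : bvec R d) := (enorm (x : 'cV[R]_d) ^+ 2)%:E.
have mf : measurable_fun setT f by apply/measurable_EFinP; exact: measurable_enorm_sq.
have f0 x : (0 <= f x)%E by rewrite lee_fin sqr_ge0.
pose X0' : {RV P >-> bvec R d} :=
  HB.pack_for {RV P >-> bvec R d} X0 (isMeasurableFun.Build _ _ _ _ _ mX0).
pose Y0' : {RV P >-> bvec R d} :=
  HB.pack_for {RV P >-> bvec R d} (Y 0 j) (isMeasurableFun.Build _ _ _ _ _ mY0).
have <- : (\int[distribution P Y0']_x f x = \int[P]_w (enorm (Y 0 j w) ^+ 2)%:E)%E.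
  exact: ge0_integral_distribution.
apply: le_lt_trans X0_moment2.
have <- : (\int[distribution P X0']_x f x = \int[P]_w (enorm (X0 w) ^+ 2)%:E)%E.
  exact: ge0_integral_distribution.
rewrite le_eqVlt; apply/orP; left; apply/eqP.
apply: eq_measure_integral => A mA _.
apply: (ic_law hcopies j (C := [set z | A z.1])).
by apply: sub_sigma_algebra; left; exists A.
Qed.

Let integrable_mean_sq k :
  (forall j, P.-integrable setT (fun w => (enorm (Y k j w) ^+ 2)%:E)) ->
  P.-integrable setT (fun w => (mean_sq k w)%:E).
Proof.
move=> iY; under eq_fun do rewrite /mean_sq EFinM -sumEFin.
by apply: integrableZl => //; exact: integrable_sum.
Qed.

Let integrable_dominated (f : T -> R) k j (A B : R) :
  (forall i, P.-integrable setT (fun w => (enorm (Y k i w) ^+ 2)%:E)) ->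
  measurable_fun setT f -> (forall w, 0 <= f w) ->
  (forall w, f w <= A * enorm (Y k j w) ^+ 2 + B * mean_sq k w) ->
  P.-integrable setT (fun w => (f w)%:E).
Proof.
move=> iY mf f0 fle.
have i1 := integrableZl measurableT A (iY j).
have i2 := integrableZl measurableT B (integrable_mean_sq iY).
apply: (le_integrable _ _ _ (integrableD _ i1 i2)) => //.
  exact/measurable_EFinP.
move=> w _ /=; rewrite lee_fin ger0_norm//; apply: le_trans (fle w) _.
exact: ler_norm.
Qed.

Let step k j :
  (forall i, P.-integrable setT (fun w => (enorm (Y k i w) ^+ 2)%:E)) ->
  [/\ P.-integrable setT (fun w => (enorm (a k j w) ^+ 2)%:E),
      P.-integrable setT (fun w => (fnorm (s k j w) ^+ 2)%:E) &
   (\int[P]_w (enorm (Y k.+1 j w) ^+ 2)%:E <=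
    \int[P]_w (enorm (a k j w) ^+ 2 + D * m%:R * fnorm (s k j w) ^+ 2)%:E)%E].
Proof.
move=> iY.
pose t := k%:R * D.
have mY i : measurable_fun setT (Y k i : pastT t -> bvec R d).
  exact: measurable_Y_past.
have ma := measurable_a j mY; have ms := measurable_s j mY.
have ia : P.-integrable setT (fun w => (enorm (a k j w) ^+ 2)%:E).
  apply: (integrable_dominated iY) (enorm_drift_sq_le k j) => [|w]; last exact: sqr_ge0.
  exact: (measurableT_comp (@measurable_enorm_sq R d) (measurable_past_bvec ma)).
have ifs : P.-integrable setT (fun w => (fnorm (s k j w) ^+ 2)%:E).
  apply: (integrable_dominated iY) (fnorm_sigma_sq_le k j) => [|w]; last exact: sqr_ge0.
  under eq_fun do rewrite fnorm_sq.
  apply: measurable_sum => i; apply: measurable_sum => l; apply: measurable_funX.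
  exact: (measurableT_comp (@measurable_coord R d m i l) (measurable_past_bvec ms)).
split => //.
have mB (l : 'I_m) (B : set R) : measurable B -> @borel_mx R m 1 [set x | B (x l 0)].
  by move=> mB; have := @measurable_coord R m 1 l 0 measurableT B mB; rewrite setTI.
apply: (@one_step_moment2_le R disp T P (past_rect Wc X0c t) d m
  (a k j) (s k j) (xi k j) D) => //.
- by move=> A; exact: (past_measurable hcopies).
- exact: measurable_past_bvec (measurable_xi j (lexx _)).
- move=> l A B mA hB.
  exact: (increment_past_indep hF hW X0_meas hcopies j (kD_ge0 k) (kDS k)
    (mB l B hB) mA).
- move=> l B hB; have tE : k.+1%:R * D - k%:R * D = D.
    by rewrite -mulrBl -natrB// subSnn mul1r.
  have := increment_normal hW hcopies j l (kD_ge0 k) (kDS k) hB.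
  by rewrite tE.
Qed.

(** The one-step bound holds in the extended reals before its left side is known to be finite, so
    the finite right side at step [k] yields integrability at step [k.+1]. *)
Lemma integrable_euler_sq k j :
  P.-integrable setT (fun w => (enorm (Y k j w) ^+ 2)%:E).
Proof.
elim: k j => [|k IH] j; apply/integrableP; split; try exact: measurable_Ysq.
  under eq_integral do rewrite gee0_abs ?lee_fin ?sqr_ge0//.
  exact: initial_moment2_lty.
under eq_integral do rewrite gee0_abs ?lee_fin ?sqr_ge0//.
have [ia ifs] := step j IH; move=> /le_lt_trans; apply.
have /integrableP[_] :=
  integrableD measurableT ia (integrableZl measurableT (D * m%:R) ifs).
apply: le_lt_trans; rewrite le_eqVlt; apply/orP; left; apply/eqP.
apply: eq_integral => w _; rewrite /= ger0_norm//.
by rewrite addr_ge0 ?sqr_ge0// mulr_ge0 ?sqr_ge0// mulr_ge0// ltW.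
Qed.

(** Expanding, (iii) bounds the part of order [D] and (ii) the part of order [D^2]. After averaging,
    the coefficients add up to [1 - D (c1 - c2) + D^2 (b1 + b2)], and [1 - x <= exp (- x)] holds for
    every real [x]. *)
Let drift_le k w :
  N%:R^-1 * \sum_(i < N) (enorm (a k i w) ^+ 2 + D * m%:R * fnorm (s k i w) ^+ 2)
  <= expR (- (D * (c1 - c2 - D * (b1 + b2)))) * mean_sq k w.
Proof.
apply: (@le_trans _ _ ((1 - D * (c1 - c2 - D * (b1 + b2))) * mean_sq k w)); last first.
  by rewrite ler_wpM2r// expR_ge1Dx.
have N0 : 0 < N%:R :> R by rewrite ltr0n.
apply: (@le_trans _ _ (N%:R^-1 * \sum_(i < N)
   ((1 - D * c1 + D ^+ 2 * b1) * enorm (Y k i w) ^+ 2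
    + (D * c2 + D ^+ 2 * b2) * mean_sq k w))).
  rewrite ler_pM2l ?invr_gt0//; apply: ler_sum => i _.
  have h := hii (Y k i w) (mu k w); have h' := hiii (Y k i w) (mu k w).
  rewrite moment2_mu -/(s k i w) in h h'.
  rewrite enormD_sq dotvZr enormZ_sq.
  have : D ^+ 2 * enorm (b (Y k i w) (mu k w)) ^+ 2 <=
    D ^+ 2 * (b1 * enorm (Y k i w) ^+ 2 + b2 * mean_sq k w).
    by rewrite ler_wpM2l ?sqr_ge0.
  have : D * (2 * dotv (Y k i w) (b (Y k i w) (mu k w))
     + m%:R * fnorm (s k i w) ^+ 2)
   <= D * (- c1 * enorm (Y k i w) ^+ 2 + c2 * mean_sq k w).
    by rewrite ler_wpM2l// ltW.
  lra.
rewrite big_split/= -mulr_sumr sumr_const card_ord mulrDr mulrCA -/(mean_sq k w).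
rewrite -[X in N%:R^-1 * X]mulr_natl mulKf ?gt_eqF//.
by rewrite le_eqVlt; apply/orP; left; apply/eqP; ring.
Qed.

Lemma measurable_mean_sq k : measurable_fun setT (mean_sq k).
Proof.
apply: measurable_funM => //; apply: measurable_sum => i.
by apply/measurable_EFinP; exact: measurable_Ysq.
Qed.

Lemma euler_moment_contraction k :
  (\int[P]_w (mean_sq k.+1 w)%:E <=
   (expR (- (D * (c1 - c2 - D * (b1 + b2)))))%:E * \int[P]_w (mean_sq k w)%:E)%E.
Proof.
have iY := integrable_euler_sq k.
have mm i : measurable_fun setT
    (fun w => (enorm (a k i w) ^+ 2 + D * m%:R * fnorm (s k i w) ^+ 2)%:E).
  have [ia ifs _] := step i iY.
  exact: measurable_int
    (integrableD measurableT ia (integrableZl measurableT (D * m%:R) ifs)).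
have c0 i w : 0 <= enorm (a k i w) ^+ 2 + D * m%:R * fnorm (s k i w) ^+ 2.
  by rewrite addr_ge0 ?sqr_ge0// mulr_ge0 ?sqr_ge0// mulr_ge0// ltW.
have N0 : 0 <= N%:R^-1 :> R by rewrite invr_ge0.
rewrite -ge0_integralZl ?lee_fin ?expR_ge0//; last 2 first.
- by apply/measurable_EFinP; exact: measurable_mean_sq.
- by move=> w _; rewrite lee_fin.
apply: (@le_trans _ _ (\int[P]_w (N%:R^-1 * \sum_(i < N)
  (enorm (a k i w) ^+ 2 + D * m%:R * fnorm (s k i w) ^+ 2))%:E)%E); last first.
  apply: ge0_le_integral => //.
  - by move=> w _; rewrite lee_fin mulr_ge0// sumr_ge0.
  - apply/measurable_EFinP; apply: measurable_funM => //.
    by apply: measurable_sum => i; apply/measurable_EFinP; exact: mm.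
  - apply: emeasurable_funM => //; apply/measurable_EFinP.
    exact: measurable_mean_sq.
  - by move=> w _; rewrite -EFinM lee_fin drift_le.
under eq_integral do rewrite EFinM -sumEFin.
under [leRHS]eq_integral do rewrite EFinM -sumEFin.
rewrite !ge0_integralZl ?lee_fin//; last 4 first.
- by apply: emeasurable_sum => i.
- by move=> w _; apply: sume_ge0 => i _; rewrite lee_fin.
- by apply: emeasurable_sum => i; exact: measurable_Ysq.
- by move=> w _; apply: sume_ge0 => i _; rewrite lee_fin sqr_ge0.
rewrite !ge0_integral_sum//; last 2 first.
- by move=> i w _; rewrite lee_fin.
- by move=> i w _; rewrite lee_fin sqr_ge0.
apply: lee_wpmul2l; first by rewrite lee_fin.
by apply: lee_sum => i _; have [_ _] := step i iY.
Qed.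

Lemma euler_moment_decay : exists2 C : R, 0 <= C & forall k,
  (\int[P]_w (mean_sq k w)%:E <=
   (C * expR (- (k%:R * (D * (c1 - c2 - D * (b1 + b2))))))%:E)%E.
Proof.
set x := D * _.
have e00 : (0 <= \int[P]_w (mean_sq 0 w)%:E)%E.
  by apply: integral_ge0 => w _; rewrite lee_fin.
have e0fin : (\int[P]_w (mean_sq 0 w)%:E)%E \is a fin_num.
  exact: integrable_fin_num (integrable_mean_sq (integrable_euler_sq 0)).
exists (fine (\int[P]_w (mean_sq 0 w)%:E)); first exact: fine_ge0.
elim=> [|k IH]; first by rewrite mul0r oppr0 expR0 mulr1 fineK.
apply: le_trans (euler_moment_contraction k) _.
apply: (le_trans (lee_wpmul2l _ IH)); first by rewrite lee_fin expR_ge0.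
rewrite -EFinM lee_fin mulrCA -expRD -/x le_eqVlt; apply/orP; left; apply/eqP.
by congr (_ * expR _); rewrite -natr1; ring.
Qed.

End euler_moments.

(** * From moment decay to the almost sure rate *)

(** [limn_esup] is an infimum of suprema over neighborhoods of infinity, and the set where the bound
    holds is one of them. *)
Lemma limn_esup_le_near {R : realType} (u : (\bar R)^nat) (l : \bar R) :
  (\forall k \near \oo, u k <= l)%E -> (limn_esup u <= l)%E.
Proof.
move=> ul; apply: ge_ereal_inf; exists (ereal_sup (u @` [set k | u k <= l]%E)).
  by exists [set k | u k <= l]%E.
by apply: ge_ereal_sup => _ [k /= ? <-].
Qed.

Section almost_sure_rate.
Context {R : realType} {disp : measure_display} {T : measurableType disp}
  (P : probability T R) (S : nat -> T -> R) (D xi C : R).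
Hypothesis D0 : 0 < D.
Hypothesis C0 : 0 <= C.
Hypothesis mS : forall k, measurable_fun setT (S k).
Hypothesis S0 : forall k w, 0 <= S k w.
Hypothesis ES : forall k,
  (\int[P]_w (S k w)%:E <= (C * expR (- (k%:R * (D * xi))))%:E)%E.

Let weight (e : R) k := expR (k%:R * (D * (xi - e))).

(* By Tonelli the sum has finite expectation when [0 < e], hence it is almost
   surely finite and bounds each [S k w] by [V e w / weight e k]. *)
Let V e w := (\sum_(k <oo) (S k w * weight e k)%:E)%E.

Let mterm e k : measurable_fun setT (fun w => (S k w * weight e k)%:E).
Proof. by apply/measurable_EFinP; exact: measurable_funM. Qed.

Let term_ge0 e k w : (0 <= (S k w * weight e k)%:E)%E.
Proof. by rewrite lee_fin mulr_ge0 ?expR_ge0. Qed.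

Let V_ge0 e w : (0 <= V e w)%E.
Proof. by apply: nneseries_ge0 => k _ _; exact: term_ge0. Qed.

(** The weight grows at rate [xi - e] against a decay at rate [xi], so the expectations are
    dominated by a geometric series of ratio [exp (- D e)]. *)
Let integral_V e : 0 < e -> (\int[P]_w V e w < +oo)%E.
Proof.
move=> e0; rewrite integral_nneseries//.
pose q := expR (- (D * e)).
have q1 : q < 1 by rewrite -[ltRHS]expR0 ltr_expR oppr_lt0 mulr_gt0.
have q0 : 0 <= q by exact: expR_ge0.
apply: (@le_lt_trans _ _ (C / (1 - q))%:E); last exact: ltry.
apply: lime_le.
  by apply: is_cvg_nneseries => k _ _; apply: integral_ge0 => w _; exact: term_ge0.
apply: nearW => n.
apply: (@le_trans _ _ (\sum_(0 <= k < n) (C * q ^+ k)%:E)%E).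
  apply: lee_sum => k _.
  under eq_integral do rewrite mulrC EFinM.
  rewrite ge0_integralZl ?lee_fin ?expR_ge0//; last 2 first.
  - exact/measurable_EFinP.
  - by move=> w _; rewrite lee_fin.
  apply: le_trans (lee_wpmul2l _ (ES k)) _; first by rewrite lee_fin expR_ge0.
  rewrite -EFinM lee_fin mulrCA -expRD /q -expRM_natl ler_wpM2l// ler_expR.
  by rewrite -mulr_natl; lra.
rewrite sumEFin lee_fin.
have -> : \sum_(0 <= k < n) C * q ^+ k = C * (1 - q ^+ n) / (1 - q).
  by have := geometric_seriesE C (negbT (lt_eqF q1)) => /(congr1 (fun f => f n)).
rewrite ler_pM2r ?invr_gt0 ?subr_gt0// ler_piMr//.
by rewrite gerBl exprn_ge0.
Qed.

(** From [S k w <= M exp (- k D (xi - e))] the rate is at most [- xi + e + ln M / (k D)]; the second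
    [e] absorbs the last term for large [k]. *)
Let bound e w : 0 < e -> (V e w < +oo)%E ->
  (limn_esup (fun k => ((k%:R * D)^-1)%:E * lne (S k w)%:E) <= (- xi + 2 * e)%:E)%E.
Proof.
move=> e0 Vfin.
have Vfn : V e w \is a fin_num by rewrite ge0_fin_numE.
(* The [+ 1] makes [M] positive even when the series vanishes, so that [ln M] can be used. *)
pose M := fine (V e w) + 1.
have M0 : 0 < M by rewrite ltr_wpDl// fine_ge0.
have SM k : S k w <= M * expR (- (k%:R * (D * (xi - e)))).
  rewrite -ler_pdivrMr ?expR_gt0// expRN invrK.
  apply: (@le_trans _ _ (fine (V e w))); last by rewrite lerDl.
  rewrite -lee_fin fineK// /V (@nneseriesD1 R (fun k => (S k w * weight e k)%:E) k
    xpredT (fun i _ => term_ge0 e i w))// leeDl//.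
  by apply: nneseries_ge0 => i _ _; exact: term_ge0.
apply: limn_esup_le_near.
(* Beyond this index [ln M <= k D e]; the successor also forces [k > 0]. *)
exists (Num.bound `|ln M / (D * e)|).+1 => // k kM.
have k0 : 0 < k%:R :> R by rewrite ltr0n; apply: leq_trans kM.
have kD0 : 0 < k%:R * D by rewrite mulr_gt0.
have [Sk0|Skn0] := leP (S k w) 0.
  by rewrite le0_lneNy ?lee_fin// gt0_muleNy ?lte_fin ?invr_gt0// leNye.
rewrite lne_EFin// -EFinM lee_fin ler_pdivrMl//.
have : ln (S k w) <= ln M - k%:R * (D * (xi - e)).
  rewrite -[X in _ - X]opprK opprK -[X in _ + X]expRK -lnM ?posrE ?expR_gt0//.
  by rewrite ler_ln ?posrE ?mulr_gt0 ?expR_gt0.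
move=> /le_trans; apply.
suff : ln M <= k%:R * (D * e) by nra.
rewrite -ler_pdivrMr ?mulr_gt0//.
apply: (@le_trans _ _ (Num.bound `|ln M / (D * e)|)%:R); last by rewrite ler_nat ltnW.
by apply: le_trans (ler_norm _) _; apply/ltW/archi_boundP.
Qed.

Lemma ae_limn_esup_log :
  {ae P, forall w,
    (limn_esup (fun k => ((k%:R * D)^-1)%:E * lne (S k w)%:E) <= (- xi)%:E)%E}.
Proof.
(* The exceptional null set depends on [e], so [e] is restricted to the countable family
   [1 / (n + 1)]. *)
have aeV n : {ae P, forall w, (V n.+1%:R^-1 w < +oo)%E}.
  have iV : P.-integrable setT (V n.+1%:R^-1).
    apply/integrableP; split.
      by apply: ge0_emeasurable_sum => // k w _ _; exact: term_ge0.
    by under eq_integral do rewrite gee0_abs//; apply: integral_V; rewrite invr_gt0.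
  have := integrable_ae measurableT iV; apply: filterS => w /(_ I).
  by rewrite ge0_fin_numE.
have := ae_foralln aeV; apply: filterS => w Vw.
apply/lee_addgt0Pr => e e0.
pose n := Num.bound (2 / e).
have n0 : 0 < n.+1%:R^-1 :> R by rewrite invr_gt0.
apply: (le_trans (bound n0 (Vw n))).
rewrite -EFinD lee_fin lerD2l ler_pdivrMr// mulrC -ler_pdivrMr//.
apply: (@le_trans _ _ n%:R); last by rewrite ler_nat.
by apply/ltW/archi_boundP; rewrite divr_ge0// ltW.
Qed.

End almost_sure_rate.

Theorem theorem4p4
  (R : realType) (disp : measure_display) (T : measurableType disp)
  (P : probability T R) (F : R -> set (set T)) (hF : usual_filtration P F)
  (d m N : nat) (hd : (0 < d)%N) (hm : (0 < m)%N) (hN : (0 < N)%N)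
  (b : 'cV[R]_d -> P2 R d -> 'cV[R]_d)
  (sigma : 'cV[R]_d -> P2 R d -> 'M[R]_(d, m))
  (b_meas : borel_measurable_xmu b) (sigma_meas : borel_measurable_xmu sigma)
  (b_lip : locally_lipschitz_x b) (sigma_lip : locally_lipschitz_x sigma)
  (W : R -> T -> 'cV[R]_m) (hW : brownian_motion P F W)
  (X0 : T -> 'cV[R]_d) (X0_meas : measurable_wrt (F 0) X0)
  (X0_neq0 : ~ {ae P, forall w, X0 w = 0})
  (X0_moments : forall p : R, 2 <= p ->
    (\int[P]_w (enorm (X0 w) `^ p)%:E < +oo)%E)
  (Wc : 'I_N -> R -> T -> 'cV[R]_m) (X0c : 'I_N -> T -> 'cV[R]_d)
  (hcopies : independent_copies P W X0 Wc X0c)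
  (K1 K2 b1 b2 c1 c2 : R)
  (K1_gt0 : 0 < K1) (K2_gt0 : 0 < K2)
  (hi : forall (x y : 'cV[R]_d) (mu nu : P2 R d),
    2 * dotv (x - y) (b x mu - b y nu) + fnorm (sigma x mu - sigma y nu) ^+ 2
      <= - K1 * enorm (x - y) ^+ 2 + K2 * W2 mu nu ^+ 2)
  (b1_gt0 : 0 < b1) (b2_gt0 : 0 < b2)
  (hii : forall (x : 'cV[R]_d) (mu : P2 R d),
    enorm (b x mu) ^+ 2 <= b1 * enorm x ^+ 2 + b2 * moment2 mu ^+ 2)
  (hiii : forall (x : 'cV[R]_d) (mu : P2 R d),
    2 * dotv x (b x mu) + m%:R * fnorm (sigma x mu) ^+ 2
      <= - c1 * enorm x ^+ 2 + c2 * moment2 mu ^+ 2)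
  (c2_gt0 : 0 < c2) (c2_lt_c1 : c2 < c1) :
  exists D0 : R, 0 < D0 < 1 /\
  exists xi : R -> R,
    [/\ forall D : R, 0 < D < D0 -> 0 < xi D,
        xi D @[D --> 0^'+] --> c1 - c2 &
        forall D : R, stepsize D -> 0 < D < D0 ->
        {ae P, forall w,
          (limn_esup (fun k : nat =>
             ((k%:R * D)^-1)%:E *
             lne (N%:R^-1 * \sum_(i < N)
                    enorm (euler b sigma hN D Wc X0c k i w) ^+ 2)%:E)
           <= (- xi D)%:E)%E}].
Proof.
have c1_gt0 : 0 < c1 by exact: lt_trans c2_lt_c1.
have b_gt0 : 0 < b1 + b2 by rewrite addr_gt0.
have c_gt0 : 0 < c1 - c2 by rewrite subr_gt0.
have X0_moment2 : (\int[P]_w (enorm (X0 w) ^+ 2)%:E < +oo)%E.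
  have := X0_moments 2 (lexx _).
  by under eq_integral do rewrite powR_mulrn ?sqrtr_ge0//.
(* The first bound keeps the threshold below 1; the second is the value of [D] at which the rate
   [c1 - c2 - D (b1 + b2)] vanishes. *)
exists (Num.min 2^-1 ((c1 - c2) / (b1 + b2))); split.
  by rewrite lt_min invr_gt0 ltr0n divr_gt0//= gt_min invf_lt1 ?ltr1n.
exists (fun D => c1 - c2 - D * (b1 + b2)); split.
- move=> D /andP[_]; rewrite lt_min => /andP[_].
  by rewrite ltr_pdivlMr// subr_gt0.
- suff : c1 - c2 - D * (b1 + b2) @[D --> 0^'+] --> c1 - c2 - 0 * (b1 + b2).
    by rewrite mul0r subr0.
  apply: cvg_at_right_filter; apply: cvgB; first exact: cvg_cst.
  by apply: cvgMl; exact: cvg_id.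
- move=> D _ /andP[D0 _].
  have [C C0 EC] := euler_moment_decay hF hm hN b_meas sigma_meas hW X0_meas
    hcopies hii hiii c1_gt0 X0_moment2 D0.
  apply: (ae_limn_esup_log D0 C0 _ _ EC).
  + exact: (measurable_mean_sq hN b_meas sigma_meas hcopies D0).
  + move=> k w; rewrite mulr_ge0 ?invr_ge0// sumr_ge0// => i _; exact: sqr_ge0.
Qed.
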